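(* Let $P,Q$ be distributions over $x=(x_1,\dots,x_d)\in\mathbb{R}^d$ with matching marginals (for each $i$, the law of $x_i$ under $P$ equals that under $Q$), with $\mathrm{Var}(x_i)>0$ for each $i$, and assume that under both $P$ and $Q$, for every $i,j\in[d]$ the pair $(x_i,x_j)$ has a two-dimensional Gaussian distribution. Let $\tilde x_i=(x_i-\mathbb{E}_P[x_i])\mathrm{Var}(x_i)^{-1/2}$ and $\tilde\Sigma_P=\mathbb{E}_P[\tilde x\tilde x^\top]$. Let $\mathcal{F}=\{\sum_{i=1}^d f_i(x_i): f_i:\mathbb{R}\to\mathbb{R},\ \mathbb{E}_P[f_i(x_i)^2]<\infty\ \forall i\}$. Then $$\tau(P,Q,\mathcal{F})\le \frac{d}{\lambda_{\min}(\tilde\Sigma_P)}.$$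
   Context: $\tau(P,Q,\mathcal{F})=\sup_{f,g\in\mathcal{F}}\mathbb{E}_Q[(f(x)-g(x))^2]/\mathbb{E}_P[(f(x)-g(x))^2]$ with the convention $0/0=0$. $\mathrm{Var}(x_i)$ is the variance of $x_i$ (the same under $P$ and $Q$). $\lambda_{\min}$ is the smallest eigenvalue; the bound is $+\infty$ if it is $0$. *)

(* Defs.v *)
From HB Require Import structures.
From mathcomp Require Import all_boot all_order all_algebra.
From mathcomp Require Import all_classical all_reals all_analysis.
Set Implicit Arguments. Unset Strict Implicit. Unset Printing Implicit Defensive.
Import Order.TTheory GRing.Theory Num.Theory.
Import numFieldNormedType.Exports.
Local Open Scope classical_set_scope.
Local Open Scope ring_scope.

Section defs.
Context {R : realType} {dT : measure_display} {T : measurableType dT}.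

Definition Exp (P : probability T R) (Y : T -> R) : R :=
  fine (\int[P]_w (Y w)%:E)%E.

Definition gaussian_law (P : probability T R) (Y : T -> R) : Prop :=
  exists m s : R,
    (s = 0 /\ forall A : set R, measurable A -> P (Y @^-1` A) = \d_m A) \/
    (0 < s /\ forall A : set R, measurable A ->
                P (Y @^-1` A) = normal_prob m s A).

Definition bivariate_gaussian (P : probability T R) (Y1 Y2 : T -> R) : Prop :=
  forall a b : R, gaussian_law P (fun w => a * Y1 w + b * Y2 w).

Definition lambda_min (n : nat) (A : 'M[R]_n) : R :=
  inf [set a : R | eigenvalue A a].

(* the function class F = { sum_i f_i(x_i) : E_P[f_i(x_i)^2] < oo } , given by
   its component functions f_i *)
Definition additive_component (n : nat) (P : probability T R)
    (X : 'I_n -> T -> R) (f : 'I_n -> R -> R) : Prop :=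
  forall i, measurable_fun setT (f i) /\
    (\int[P]_w ((f i (X i w)) ^+ 2)%:E < +oo)%E.

Definition additive_eval (n : nat) (X : 'I_n -> T -> R) (f : 'I_n -> R -> R)
    (w : T) : R := \sum_(i < n) f i (X i w).

Definition eratio (a b : \bar R) : \bar R :=
  if b == 0%E then (if a == 0%E then 0%E else +oo%E) else (a / b)%E.

Definition tau (n : nat) (P Q : probability T R) (X : 'I_n -> T -> R) : \bar R :=
  ereal_sup [set r : \bar R | exists f g : 'I_n -> R -> R,
     [/\ additive_component P X f, additive_component P X g &
       r = eratio
         (\int[Q]_w ((additive_eval X f w - additive_eval X g w) ^+ 2)%:E)%E
         (\int[P]_w ((additive_eval X f w - additive_eval X g w) ^+ 2)%:E)%E]].

Definition mean (P : probability T R) (Y : T -> R) : R := Exp P Y.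
Definition var (P : probability T R) (Y : T -> R) : R :=
  Exp P (fun w => (Y w - mean P Y) ^+ 2).

Definition tildeSigma (n : nat) (P : probability T R) (X : 'I_n -> T -> R)
  : 'M[R]_n :=
  \matrix_(i, j) Exp P (fun w =>
      ((X i w - mean P (X i)) / Num.sqrt (var P (X i))) *
      ((X j w - mean P (X j)) / Num.sqrt (var P (X j)))).

End defs.

(* Main.v *)
(* Since the marginals agree, the second moment of a centred sum of n functions under Q is
   at most n times the sum of the variances, and everything reduces to the lower bound
   Var_P(sum_i f_i(x_i)) >= lambda_min * sum_i Var_P(f_i(x_i)).  For trigonometric f_i the
   pairwise Gaussian law gives E[cas(t Y_i) cas(s Y_j)] = e^{-t^2/2} e^{-s^2/2} e^{rho_ij t s}
   for the standardized variables Y_i (cas = cos + sin), so that expanding e^{rho_ij t s}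
   turns the bound into positivity of (rho_ij^k) - lambda_min I for all k >= 1; this follows
   from the case k = 1 by Schur products, rho having unit diagonal.  The general case follows
   because trigonometric sums are dense in L^2 of the law of Y_i. *)
Require Import Defs.
From HB Require Import structures.
From mathcomp Require Import all_boot all_order all_algebra.
From mathcomp Require Import all_classical all_reals all_analysis.
From mathcomp Require Import measurable_realfun ring lra.
Set Implicit Arguments. Unset Strict Implicit. Unset Printing Implicit Defensive.
Import Order.TTheory GRing.Theory Num.Theory.
Import numFieldNormedType.Exports.
Local Open Scope classical_set_scope.
Local Open Scope ring_scope.

(** * The normal law *)

(** Covariances are compared, rather than second moments, because the term k = 0 of the exponential
    is the product of the means: its matrix has all entries 1, hence is singular for d > 1 and
    cannot dominate a positive multiple of the identity. The means come back only at the end. They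
    agree under P and Q, and a factor d / lambda_min is harmless for them since lambda_min <= 1 <=
    d. Second moments of a sum involve its terms two at a time, which is why pairwise Gaussianity
    suffices. Trigonometric functions take the place of the Hermite polynomials that usually
    diagonalize Gaussian correlations. They are bounded and stable under products, so every
    polynomial in a sine is again a trigonometric sum, and indicators are reached through bounded
    pointwise limits, where dominated convergence asks for no moment estimate. *)

Section normal_law.
Context {R : realType}.
Implicit Types (m s t x : R) (f F : R -> R).
Local Notation mu := (@lebesgue_measure R).

Lemma ge0_integral_normal_prob m s f : measurable_fun setT f -> (forall x, 0 <= f x) ->
  (\int[normal_prob m s]_x (f x)%:E =
   \int[mu]_x (f x * normal_pdf m s x)%:E)%E.
Proof.
move=> mf f0.
have dom := normal_prob_dominates m s.
rewrite -(@Radon_Nikodym_SigmaFinite.change_of_variables _ _ _ (normal_prob m s) mu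
  dom (fun x => (f x)%:E) setT)//; do ?[exact/measurable_EFinP|by move=> x; rewrite lee_fin; exact: f0].
under [RHS]eq_integral do rewrite EFinM.
have mp : measurable_fun [set: R] (EFin \o normal_pdf m s).
  by apply/measurable_EFinP; exact: measurable_normal_pdf.
have mg : measurable_fun [set: R] (Radon_Nikodym_SigmaFinite.f (normal_prob m s) mu).
  by apply: (measurable_int mu); exact: Radon_Nikodym_SigmaFinite.f_integrable.
apply: ae_eq_integral => //.
- by apply: emeasurable_funM => //; exact/measurable_EFinP.
- by apply: emeasurable_funM => //; exact/measurable_EFinP.
(* The Radon-Nikodym derivative and [normal_pdf] have the same integral over every measurable set,
   so they agree almost everywhere. *)
- apply: ae_eqe_mul2l; apply: integral_ae_eq => //.
    exact: Radon_Nikodym_SigmaFinite.f_integrable.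
  by move=> E _ mE; rewrite -Radon_Nikodym_SigmaFinite.f_integral.
Qed.

(** The fundamental theorem of calculus on growing symmetric intervals, with dominated convergence
    for the integrals. This is the integration by parts behind Stein's identity. *)
Lemma Rintegral_derive_eq0 f F : (forall x, is_derive x 1 F (f x)) ->
  continuous f -> mu.-integrable setT (EFin \o f) ->
  F n%:R @[n --> \oo] --> 0 -> F (- n%:R) @[n --> \oo] --> 0 ->
  \int[mu]_x f x = 0.
Proof.
move=> dF cf intf Fp Fn.
have mf : measurable_fun setT f by exact: continuous_measurable_fun.
(* The successor keeps the interval nondegenerate at n = 0, as the fundamental theorem of calculus
   requires. *)
pose I n : set R := `[- n.+1%:R, n.+1%:R]%classic.
have mfI n : measurable_fun setT ((EFin \o f) \_ (I n)).
  apply/(measurable_restrictT _ _).1 => //; first exact: measurable_itv.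
  exact/measurable_EFinP/measurable_funTS.
have mEf : measurable_fun setT (EFin \o f) by exact/measurable_EFinP.
have cI : {ae mu, forall x, setT x ->
    ((EFin \o f) \_ (I n)) x @[n --> \oo] --> (EFin \o f) x}.
  apply: aeW => x _; apply: cvg_near_cst.
  near=> n; rewrite patchE mem_set// /I/= in_itv/= -ler_norml.
  have : `|x| < n%:R by near: n; exact: nbhs_infty_gtr.
  by move=> /ltW h; apply: (le_trans h); rewrite ler_nat.
have dI : {ae mu, forall x n, setT x ->
    (`|((EFin \o f) \_ (I n)) x| <= (abse \o (EFin \o f)) x)%E}.
  by apply: aeW => x n _; rewrite patchE; case: ifP => [_|_]; [exact: lexx|rewrite abse0; exact: abse_ge0].
have [_ _ cv] := @dominated_convergence _ _ _ mu _ measurableT _ _ _ mfI mEf cI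
  (integrable_abse intf) dI.
have e n : (\int[mu]_x ((EFin \o f) \_ (I n)) x = (F n.+1%:R - F (- n.+1%:R))%:E)%E.
  rewrite -integral_mkcond (@continuous_FTC2 _ f F)//.
  - by apply: (lt_le_trans (_ : _ < 0)) => //; rewrite oppr_lt0.
  - exact: continuous_subspaceT.
  - have cF : forall x, F y @[y --> x] --> F x.
      move=> x; apply: differentiable_continuous; apply/derivable1_diffP.
      by have [] := dF x.
    split.
    + by move=> x _; have [] := dF x.
    + exact: cvg_at_right_filter.
    + exact: cvg_at_left_filter.
  - by move=> x _; rewrite derive1E; have [] := dF x.
rewrite /Rintegral -(cvg_lim _ cv)//.
rewrite (_ : (fun n => _) = (fun n => (F n.+1%:R - F (- n.+1%:R))%:E)); last exact/funext.
have : (F n.+1%:R - F (- n.+1%:R))%:E @[n --> \oo] --> 0%:E.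
  apply: cvg_EFin; first exact: nearW.
  rewrite -[0](subr0 0); apply: cvgB.
    by rewrite (cvg_shiftS (fun n => F n%:R)).
  by rewrite (cvg_shiftS (fun n => F (- n%:R))).
by move/cvg_lim => ->.
Unshelve. all: by end_near. Qed.

End normal_law.

(** * Gaussian tails and Stein's identity *)

Section normal_moments.
Context {R : realType}.
Implicit Types (m s t x : R) (f g : R -> R).
Local Notation mu := (@lebesgue_measure R).

Lemma normal_pdf_exp m s x : 0 < s ->
  normal_pdf m s x = normal_peak s * expR (- (x - m) ^+ 2 / (s ^+ 2 *+ 2)).
Proof. by move=> s0; rewrite normal_pdfE ?gt_eqF// /normal_fun. Qed.

(** A quadratic factor is paid for by doubling the standard deviation. With y = (x - m)^2 one has y
    <= 8 s^2 exp(y / (8 s^2)), and the exponents compare as 1/8 - 1/2 = -3/8 <= -1/8 in units of y /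
    s^2. Integrability against quadratic growth then reduces to that of the density itself. *)
Lemma sqr_normal_pdf_le m s x : 0 < s ->
  (x - m) ^+ 2 * normal_pdf m s x <=
  8 * s ^+ 2 * (normal_peak s / normal_peak (2 * s)) * normal_pdf m (2 * s) x.
Proof.
move=> s0; have s20 : 0 < 2 * s by rewrite mulr_gt0.
rewrite !normal_pdf_exp//.
have p0 : 0 < normal_peak s by apply: normal_peak_gt0; rewrite gt_eqF.
have p20 : 0 < normal_peak (2 * s) by apply: normal_peak_gt0; rewrite gt_eqF.
set e2 := expR _; set e1 := expR _.
have -> : 8 * s ^+ 2 * (normal_peak s / normal_peak (2 * s)) * (normal_peak (2 * s) * e1)
    = 8 * s ^+ 2 * e1 * normal_peak s by field; rewrite gt_eqF.
have -> : (x - m) ^+ 2 * (normal_peak s * e2) = ((x - m) ^+ 2 * e2) * normal_peak s by ring.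
rewrite ler_pM2r//.
have s2 : 0 < s ^+ 2 by rewrite exprn_gt0.
set y := (x - m) ^+ 2; have y0 : 0 <= y by rewrite sqr_ge0.
have h1 : y <= 8 * s ^+ 2 * expR (y / (8 * s ^+ 2)).
  rewrite -ler_pdivrMl ?mulr_gt0// mulrC.
  have := expR_ge1Dx (y / (8 * s ^+ 2)); lra.
apply: (le_trans (ler_wpM2r (expR_ge0 _) h1)).
rewrite -(mulrA (8 * s ^+ 2)) ler_pM2l ?mulr_gt0// /e1 /e2 -expRD ler_expR.
have -> : y / (8 * s ^+ 2) + - (x - m) ^+ 2 / (s ^+ 2 *+ 2) = - (3 / 8) * (y / s ^+ 2).
  by rewrite -mulr_natr -/y; field; rewrite gt_eqF.
have -> : - (x - m) ^+ 2 / ((2 * s) ^+ 2 *+ 2) = - (1 / 8) * (y / s ^+ 2).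
  by rewrite -mulr_natr -/y exprMn; field; rewrite gt_eqF.
have : 0 <= y / s ^+ 2 by rewrite divr_ge0// ltW.
lra.
Qed.

Lemma integrable_sqr_normal_pdf m s g (C : R) : 0 < s -> measurable_fun [set: R] g ->
  (forall x, `|g x| <= C * (1 + (x - m) ^+ 2)) ->
  mu.-integrable [set: R] (fun x => (g x * normal_pdf m s x)%:E).
Proof.
move=> s0 mg gC.
have C0 : 0 <= C.
  by have := gC m; rewrite subrr expr0n addr0 mulr1; apply: le_trans.
pose K := 8 * s ^+ 2 * (normal_peak s / normal_peak (2 * s)).
have iG : mu.-integrable [set: R]
  (fun x => (C * (normal_pdf m s x + K * normal_pdf m (2 * s) x))%:E).
  under eq_fun do rewrite EFinM EFinD EFinM.
  apply: integrableZl => //; apply: integrableD => //.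
    exact: integrable_normal_pdf.
  by apply: integrableZl => //; exact: integrable_normal_pdf.
apply: (le_integrable _ _ _ iG) => //.
  apply/measurable_EFinP; apply: measurable_funM => //.
  exact: measurable_normal_pdf.
move=> x _ /=; rewrite lee_fin normrM (ger0_norm (normal_pdf_ge0 _ _ _)).
apply: (le_trans _ (ler_norm _)).
apply: (le_trans (ler_wpM2r (normal_pdf_ge0 _ _ _) (gC x))).
rewrite -mulrA ler_wpM2l// mulrDl mul1r lerD2l.
exact: sqr_normal_pdf_le.
Qed.

(** Disposes of the boundary terms in Stein's identity: (x - m)^2 times the density is bounded, so a
    factor of linear growth leaves a decay of order 1 / |x - m|. *)
Lemma cvg_linear_normal_pdf m s g (C : R) (u : nat -> R) : 0 < s ->
  (forall x, `|g x| <= C * (1 + `|x - m|)) -> `|u n - m| @[n --> \oo] --> +oo ->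
  g (u n) * normal_pdf m s (u n) @[n --> \oo] --> 0.
Proof.
move=> s0 gC um.
have C0 : 0 <= C.
  by have := gC m; rewrite subrr normr0 addr0 mulr1; apply: le_trans.
pose K := 8 * s ^+ 2 * (normal_peak s / normal_peak (2 * s)) * normal_peak (2 * s).
have K0 : 0 <= K.
  by rewrite !mulr_ge0// ?invr_ge0 ?normal_peak_ge0// ltW.
have b x : 1 <= `|x - m| -> `|g x * normal_pdf m s x| <= 2 * C * K * `|x - m|^-1.
  move=> x1; have x0 : 0 < `|x - m| by apply: lt_le_trans x1.
  rewrite normrM (ger0_norm (normal_pdf_ge0 _ _ _)).
  apply: (le_trans (ler_wpM2r (normal_pdf_ge0 _ _ _) (gC x))).
  rewrite ler_pdivlMr//.
  have -> : C * (1 + `|x - m|) * normal_pdf m s x * `|x - m| =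
      C * ((1 + `|x - m|) * normal_pdf m s x * `|x - m|) by ring.
  have -> : 2 * C * K = C * (2 * K) by ring.
  rewrite ler_wpM2l//.
  apply: (@le_trans _ _ (2 * ((x - m) ^+ 2 * normal_pdf m s x))).
    rewrite -(real_normK (num_real (x - m))).
    have := normal_pdf_ge0 m s x; move: (normal_pdf m s x) => p p0.
    rewrite -subr_ge0.
    have -> : 2 * (`|x - m| ^+ 2 * p) - (1 + `|x - m|) * p * `|x - m| =
      p * `|x - m| * (`|x - m| - 1) by ring.
    by rewrite !mulr_ge0// subr_ge0.
  rewrite ler_pM2l//; apply: (le_trans (sqr_normal_pdf_le _ _ _)) => //.
  rewrite /K ler_wpM2l//; last first.
    by apply: normal_pdf_ub; rewrite gt_eqF// mulr_gt0.
  by rewrite !mulr_ge0// ?invr_ge0 ?normal_peak_ge0// ltW.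
apply: norm_cvg0.
apply: (@squeeze_cvgr _ _ _ _ (cst 0) (fun n => 2 * C * K * `|u n - m|^-1)).
- have u1 : \forall n \near \oo, 1 <= `|u n - m|.
    by move/cvgryPge : um; apply.
  near=> n; rewrite normr_ge0/=; apply: b.
  by near: n.
- exact: cvg_cst.
- rewrite -[0](mulr0 (2 * C * K)); apply: cvgM; first exact: cvg_cst.
  apply/gtr0_cvgV0 => //.
  near=> n; apply: (@lt_le_trans _ _ 1) => //.
  by near: n; move/cvgryPge : um; apply.
Unshelve. all: by end_near. Qed.

Lemma is_derive_normal_pdf m s x : 0 < s ->
  is_derive x 1 (normal_pdf m s) (- ((x - m) / s ^+ 2) * normal_pdf m s x).
Proof.
move=> s0.
have -> : normal_pdf m s =
    (fun x => normal_peak s * expR (- (x - m) ^+ 2 / (s ^+ 2 *+ 2))).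
  by apply/funext => y; rewrite normal_pdf_exp.
apply: is_derive_eq; rewrite /GRing.scale/=.
field; by rewrite gt_eqF.
Qed.

(** Integration by parts of [g * normal_pdf], since the density p satisfies p' = - ((x - m) / s^2)
    p. The growth bounds leave room for the functions 1, x - m and the sine, from which the mean,
    the variance and the characteristic function are obtained. *)
Lemma normal_Stein m s g (dg : R -> R) (C : R) : 0 < s ->
  (forall x, is_derive x 1 g (dg x)) -> continuous dg ->
  (forall x, `|g x| <= C * (1 + `|x - m|)) ->
  (forall x, `|dg x| <= C * (1 + (x - m) ^+ 2)) ->
  \int[mu]_x ((x - m) * g x * normal_pdf m s x) =
  s ^+ 2 * \int[mu]_x (dg x * normal_pdf m s x).
Proof.
move=> s0 dgE cdg gC dgC.
have s20 : s ^+ 2 != 0 by rewrite gt_eqF// exprn_gt0.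
have C0 : 0 <= C.
  by have := gC m; rewrite subrr normr0 addr0 mulr1; apply: le_trans.
have cg : continuous g.
  move=> x; apply: differentiable_continuous; apply/derivable1_diffP.
  by have [] := dgE x.
have cy : continuous (fun x => x - m).
  by move=> x; apply: cvgB; [exact: cvg_id|exact: cvg_cst].
have cp : continuous (normal_pdf m s) by apply: continuous_normal_pdf; rewrite gt_eqF.
have i1 : mu.-integrable [set: R] (fun x => (dg x * normal_pdf m s x)%:E).
  by apply: integrable_sqr_normal_pdf dgC => //; exact: continuous_measurable_fun.
have i2 : mu.-integrable [set: R] (fun x => ((x - m) * g x * normal_pdf m s x)%:E).
  apply: (@integrable_sqr_normal_pdf _ _ _ (2 * C)) => //.
    apply: continuous_measurable_fun => x; exact: cvgM (cy x) (cg x).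
  move=> x; rewrite normrM.
  apply: (le_trans (ler_wpM2l (normr_ge0 _) (gC x))).
  rewrite -(real_normK (num_real (x - m))); set y := `|x - m|.
  have := sqr_ge0 (1 - y); have := sqr_ge0 y => h1 h2.
  rewrite (_ : y * _ = C * (y + y ^+ 2)); last by ring.
  rewrite (_ : 2 * _ * _ = C * (2 * (1 + y ^+ 2))); last by ring.
  by rewrite ler_wpM2l//; nra.
have i2' : mu.-integrable [set: R]
    (EFin \o (fun x => (s ^+ 2)^-1 * ((x - m) * g x * normal_pdf m s x))).
  exact: (integrableZl measurableT _ i2).
pose F x := g x * normal_pdf m s x.
pose f x := dg x * normal_pdf m s x - (s ^+ 2)^-1 * ((x - m) * g x * normal_pdf m s x).
have dF x : is_derive x 1 F (f x).
  have dp := is_derive_normal_pdf m x s0.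
  have dgx := dgE x.
  rewrite /F; apply: is_derive_eq.
  by rewrite /GRing.scale/= /f; field; rewrite gt_eqF.
have norm_pinf (v : nat -> R) : (forall n, `|v n| = n%:R) -> `|v n - m| @[n --> \oo] --> +oo.
  move=> vn; apply/cvgryPge => A; near=> n.
  have : A + `|m| <= n%:R by near: n; exact: nbhs_infty_ger.
  rewrite -(vn n) => h.
  have := ler_normD (v n - m) m; rewrite subrK; lra.
have := @Rintegral_derive_eq0 R f F dF.
have -> : \int[mu]_x f x = \int[mu]_x (dg x * normal_pdf m s x) -
    (s ^+ 2)^-1 * \int[mu]_x ((x - m) * g x * normal_pdf m s x).
  by rewrite RintegralB// RintegralZl.
move=> H.
have : \int[mu]_x (dg x * normal_pdf m s x) -
    (s ^+ 2)^-1 * \int[mu]_x ((x - m) * g x * normal_pdf m s x) = 0.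
  apply: H.
  - move=> x; apply: cvgB; first exact: cvgM (cdg x) (cp x).
    apply: cvgM; first exact: cvg_cst.
    apply: cvgM (cp x); exact: cvgM (cy x) (cg x).
  - rewrite /f /comp; under eq_fun do rewrite EFinB.
    apply: integrableB => //; exact: i2'.
  - apply: (@cvg_linear_normal_pdf m s g C) => //.
    by apply: norm_pinf => n; rewrite normr_nat.
  - apply: (@cvg_linear_normal_pdf m s g C) => //.
    by apply: norm_pinf => n; rewrite normrN normr_nat.
by move/subr0_eq => ->; rewrite mulrA divff// mul1r.
Unshelve. all: by end_near. Qed.

End normal_moments.

(** * Mean, variance and characteristic function of the normal law *)

Section normal_integrals.
Context {R : realType}.
Implicit Types (m s t x : R) (f g : R -> R).
Local Notation mu := (@lebesgue_measure R).

Lemma integrable_normal_probP m s f : measurable_fun [set: R] f ->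
  mu.-integrable [set: R] (fun x => (f x * normal_pdf m s x)%:E) ->
  (normal_prob m s).-integrable [set: R] (EFin \o f) /\
  \int[normal_prob m s]_x f x = \int[mu]_x (f x * normal_pdf m s x).
Proof.
move=> mf fi.
have p0 x := normal_pdf_ge0 m s x.
split.
  apply/integrableP; split; first exact/measurable_EFinP.
  under eq_integral do rewrite /= .
  rewrite (@ge0_integral_normal_prob R m s (fun x => `|f x|))//; last first.
    exact: measurableT_comp.
  case/integrableP : fi => _; apply: le_lt_trans.
  rewrite le_eqVlt; apply/orP; left; apply/eqP.
  by apply: eq_integral => x _; rewrite /= normrM (ger0_norm (p0 _)).
rewrite /Rintegral; congr fine.
rewrite integralE [RHS]integralE; congr (_ - _)%E.
- have -> : funepos (fun x => (f x)%:E) = (fun x => (Num.max (f x) 0)%:E).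
    by apply/funext => x; rewrite funeposE -EFin_max.
  rewrite ge0_integral_normal_prob//.
  + apply: eq_integral => x _; rewrite funeposE -EFin_max; congr (_%:E).
    by rewrite maxr_pMl// mul0r.
  + exact: measurable_maxr.
  + by move=> x; rewrite le_max lexx orbT.
- have -> : funeneg (fun x => (f x)%:E) = (fun x => (Num.max (- f x) 0)%:E).
    by apply/funext => x; rewrite funenegE -EFinN -EFin_max.
  rewrite ge0_integral_normal_prob//.
  + apply: eq_integral => x _; rewrite funenegE -EFinN -EFin_max; congr (_%:E).
    by rewrite maxr_pMl// mul0r mulNr.
  + by apply: measurable_maxr => //; exact: measurableT_comp.
  + by move=> x; rewrite le_max lexx orbT.
Qed.

Lemma normal_mean m s : 0 < s -> \int[mu]_x ((x - m) * normal_pdf m s x) = 0.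
Proof.
move=> s0.
have := @normal_Stein R m s (cst 1) (cst 0) 1 s0.
rewrite (_ : (fun x => (x - m) * cst 1 x * _) = fun x => (x - m) * normal_pdf m s x); last first.
  by apply/funext => x; rewrite /cst mulr1.
move=> ->.
- rewrite (_ : (fun x => _ * _) = cst 0).
    by rewrite /Rintegral integral0 mulr0.
  by apply/funext => x; rewrite /cst mul0r.
- by move=> x; exact: cvg_cst.
- by move=> x; rewrite /cst normr1 mul1r lerDl.
- by move=> x; rewrite /cst normr0 mul1r addr_ge0// sqr_ge0.
Qed.

Lemma normal_variance m s : 0 < s ->
  \int[mu]_x ((x - m) ^+ 2 * normal_pdf m s x) = s ^+ 2.
Proof.
move=> s0.
have D x : is_derive x 1 (fun x => x - m) (cst 1 x).
  by apply: is_derive_eq; rewrite subr0.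
rewrite -[LHS](_ : \int[mu]_x ((x - m) * (x - m) * normal_pdf m s x) = _); last by [].
rewrite (@normal_Stein R m s _ (cst 1) 1 s0 D).
- under eq_Rintegral do rewrite /cst mul1r.
  by rewrite /Rintegral integral_normal_pdf mulr1.
- by move=> x; exact: cvg_cst.
- by move=> x; rewrite mul1r lerDr.
- by move=> x; rewrite /cst normr1 mul1r lerDl sqr_ge0.
Qed.

(** Differentiation under the integral followed by Stein's identity gives phi'(t) = - s^2 t phi(t),
    so phi(t) exp(s^2 t^2 / 2) is constant, equal to its value cos th at t = 0. The phase [th]
    treats cosine and sine together, in place of a complex exponential. *)
Lemma normal_cos m s t (th : R) : 0 < s ->
  \int[mu]_x (cos (t * (x - m) + th) * normal_pdf m s x) =
  cos th * expR (- (s ^+ 2 * t ^+ 2) / 2).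
Proof.
move=> s0.
pose f t x := cos (t * (x - m) + th) * normal_pdf m s x.
pose phi t := \int[mu]_x f t x.
have cc (a : R) : continuous (fun x => a * (x - m) + th).
  move=> x; apply: cvgD; last exact: cvg_cst.
  by apply: cvgM; [exact: cvg_cst|apply: cvgB; [exact: cvg_id|exact: cvg_cst]].
have mcos (a : R) : measurable_fun [set: R] (fun x => cos (a * (x - m) + th)).
  apply: continuous_measurable_fun => x.
  exact: (continuous_comp (cc a x) (@continuous_cos R _)).
have intf (a : R) : mu.-integrable [set: R] (EFin \o f a).
  apply: (@integrable_sqr_normal_pdf R m s _ 1) => // x.
  by rewrite mul1r; apply: (@le_trans _ _ 1); [rewrite ler_norml cos_geN1 cos_le1|rewrite lerDl sqr_ge0].
have d1f (a x : R) : is_derive a 1 (f ^~ x) (- ((x - m) * sin (a * (x - m) + th) * normal_pdf m s x)).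
  rewrite /f; apply: is_derive_eq.
  by rewrite /GRing.scale/=; ring.
pose G x := `|x - m| * normal_pdf m s x.
have intG : mu.-integrable [set: R] (EFin \o G).
  apply: (@integrable_sqr_normal_pdf R m s _ 1) => //.
    apply: measurableT_comp => //; apply: measurable_funB => //.
  move=> x; rewrite normr_id mul1r -(real_normK (num_real (x - m))).
  by have := sqr_ge0 (`|x - m| - 1); nra.
have G0 x : 0 <= G x by rewrite mulr_ge0// normal_pdf_ge0.
have p1f (a x : R) : partial1of2 f a x = - ((x - m) * sin (a * (x - m) + th) * normal_pdf m s x).
  by rewrite partial1of2E; have [_] := d1f a x.
have Gub (a u v : R) x y : `]u, v[%classic x -> [set: R] y -> `|partial1of2 f x y| <= G y.
  move=> _ _; rewrite p1f normrN !normrM (ger0_norm (normal_pdf_ge0 _ _ _)).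
  rewrite /G ler_wpM2r ?normal_pdf_ge0// ler_piMr// ler_norml.
  by rewrite sin_geN1 sin_le1.
have df1 (u v x y : R) : `]u, v[%classic x -> [set: R] y -> derivable (f ^~ y) x 1.
  by move=> _ _; have [] := d1f x y.
have dphi (a : R) : is_derive a 1 phi (- (s ^+ 2 * a * phi a)).
  have Ia : `](a - 1), (a + 1)[%classic a by rewrite /= in_itv/=; lra.
  have dph : derivable phi a 1.
    exact: (derivable_under_integral measurableT Ia (fun x _ => intf x) (@df1 _ _) G0 intG (@Gub a _ _)).
  apply: (DeriveDef dph).
  rewrite -derive1E (differentiation_under_integral measurableT Ia (fun x _ => intf x) (@df1 _ _) G0 intG (@Gub a _ _)).
  under eq_Rintegral do rewrite p1f -mulN1r.
  rewrite RintegralZl//; last first.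
    apply: (@integrable_sqr_normal_pdf R m s _ 1) => //.
      apply: measurable_funM; first exact: measurable_funB.
      apply: continuous_measurable_fun => x.
      exact: (continuous_comp (cc a x) (@continuous_sin R _)).
    move=> x; rewrite mul1r normrM.
    apply: (@le_trans _ _ `|x - m|).
      by rewrite ler_piMr// ler_norml sin_geN1 sin_le1.
    rewrite -(real_normK (num_real (x - m))).
    by have := sqr_ge0 (`|x - m| - 1); nra.
  have D x : is_derive x 1 (fun x => sin (a * (x - m) + th)) (a * cos (a * (x - m) + th)).
    by apply: is_derive_eq; rewrite /GRing.scale/=; ring.
  rewrite (@normal_Stein R m s _ _ (1 + `|a|) s0 D).
  - under eq_Rintegral do rewrite -mulrA.
    by rewrite (RintegralZl _ measurableT (intf a)) /phi /f mulN1r !mulrA.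
  - move=> x; apply: cvgM; first exact: cvg_cst.
    exact: (continuous_comp (cc a x) (@continuous_cos R _)).
  - move=> x; apply: (@le_trans _ _ 1).
      by rewrite ler_norml sin_geN1 sin_le1.
    by rewrite -[leLHS]mulr1 ler_pM// lerDl.
  - move=> x; rewrite normrM; apply: (@le_trans _ _ (`|a| * 1)).
      by rewrite ler_wpM2l// ler_norml cos_geN1 cos_le1.
    by apply: ler_pM => //; rewrite ?lerDr// lerDl sqr_ge0.
pose psi a := phi a * expR ((s ^+ 2 * a ^+ 2) / 2).
have dpsi (a : R) : is_derive a 1 psi 0.
  have h := dphi a.
  rewrite /psi; apply: is_derive_eq.
  by rewrite /GRing.scale/=; field.
have psi0 : psi t = cos th.
  rewrite (is_derive_0_is_cst t 0 dpsi) /psi expr0n/= mulr0 mul0r expR0 mulr1.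
  rewrite /phi /f; under eq_Rintegral do rewrite mul0r add0r.
  rewrite RintegralZl//; last exact: integrable_normal_pdf.
  by rewrite /Rintegral integral_normal_pdf mulr1.
by rewrite -psi0 /psi -(mulrA (phi t)) -expRD mulNr subrr expR0 mulr1.
Qed.

End normal_integrals.

(** * Square-integrable random variables *)

Section square_integrable.
Context {R : realType} {d : measure_display} {T : measurableType d}.
Variable P : probability T R.
Implicit Types f g h : T -> R.

Definition L2 f : Prop := measurable_fun [set: T] f /\
  P.-integrable [set: T] (fun w => (f w ^+ 2)%:E).

Definition ip f g : R := Exp P (fun w => f w * g w).

Lemma L2_measurable f : L2 f -> measurable_fun [set: T] f.
Proof. by case. Qed.

Lemma ExpD f g : P.-integrable setT (EFin \o f) -> P.-integrable setT (EFin \o g) ->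
  Exp P (fun w => f w + g w) = Exp P f + Exp P g.
Proof. exact: RintegralD. Qed.

Lemma ExpB f g : P.-integrable setT (EFin \o f) -> P.-integrable setT (EFin \o g) ->
  Exp P (fun w => f w - g w) = Exp P f - Exp P g.
Proof. exact: RintegralB. Qed.

Lemma ExpZ (c : R) f : P.-integrable setT (EFin \o f) ->
  Exp P (fun w => c * f w) = c * Exp P f.
Proof. exact: RintegralZl. Qed.

Lemma Exp_cst (c : R) : Exp P (fun=> c) = c.
Proof. by rewrite /Exp integral_cst//= probability_setT mule1. Qed.

Lemma eq_Exp f g : f =1 g -> Exp P f = Exp P g.
Proof. by move=> /funext ->. Qed.

Lemma integrable_RsumP (I : Type) (s : seq I) (F : I -> T -> R) :
  (forall i, P.-integrable setT (EFin \o F i)) ->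
  P.-integrable setT (EFin \o (fun w => \sum_(i <- s) F i w)).
Proof.
move=> iF; rewrite /comp; under eq_fun do rewrite -sumEFin.
by apply: integrable_sum => // i _; exact: iF.
Qed.

Lemma Exp_sum (I : Type) (s : seq I) (F : I -> T -> R) :
  (forall i, P.-integrable setT (EFin \o F i)) ->
  Exp P (fun w => \sum_(i <- s) F i w) = \sum_(i <- s) Exp P (F i).
Proof.
move=> iF; elim: s => [|i s IH].
  by under eq_Exp do rewrite big_nil; rewrite Exp_cst big_nil.
under eq_Exp do rewrite big_cons.
by rewrite ExpD// ?IH ?big_cons//; exact: integrable_RsumP.
Qed.

Lemma Exp_ge0 f : (forall w, 0 <= f w) -> 0 <= Exp P f.
Proof. by move=> f0; apply: Rintegral_ge0. Qed.

Lemma L2_lty f : measurable_fun [set: T] f ->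
  (\int[P]_w ((f w) ^+ 2)%:E < +oo)%E -> L2 f.
Proof.
move=> mf fi; split => //; apply/integrableP; split.
  by apply/measurable_EFinP; exact: measurable_funX.
by under eq_integral do rewrite /= ger0_norm ?sqr_ge0//.
Qed.

Lemma L2_integralE f : L2 f -> (\int[P]_w ((f w) ^+ 2)%:E)%E = (ip f f)%:E.
Proof.
move=> [mf fi]; rewrite /ip /Exp fineK; last exact: integrable_fin_num.
by under eq_integral do rewrite expr2.
Qed.

Lemma L2M_integrable f g : L2 f -> L2 g -> P.-integrable setT (fun w => (f w * g w)%:E).
Proof.
move=> [mf fi] [mg gi].
apply: (le_integrable _ _ _ (integrableD measurableT fi gi)) => //.
  by apply/measurable_EFinP; exact: measurable_funM.
move=> w _ /=; rewrite lee_fin [leRHS]ger0_norm ?addr_ge0 ?sqr_ge0// normrM.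
rewrite -(real_normK (num_real (f w))) -(real_normK (num_real (g w))).
by have := sqr_ge0 (`|f w| - `|g w|); have := mulr_ge0 (normr_ge0 (f w)) (normr_ge0 (g w)); nra.
Qed.

Lemma L2_bounded f (C : R) : measurable_fun [set: T] f -> (forall w, `|f w| <= C) -> L2 f.
Proof.
move=> mf fC; split => //.
apply: (@le_integrable _ _ _ P _ measurableT _ (fun=> (C ^+ 2)%:E)) => //.
- by apply/measurable_EFinP; exact: measurable_funX.
- move=> w _ /=; rewrite lee_fin !ger0_norm ?sqr_ge0//.
  rewrite -(real_normK (num_real (f w))) ler_sqr ?nnegrE//.
  exact: le_trans (fC w).
- exact: finite_measure_integrable_cst.
Qed.

Lemma L2_cst (c : R) : L2 (fun=> c).
Proof. by apply: (@L2_bounded _ `|c|). Qed.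

Lemma L2_integrable f : L2 f -> P.-integrable setT (EFin \o f).
Proof.
move=> Lf; have := L2M_integrable Lf (L2_cst 1).
by under eq_fun do rewrite mulr1.
Qed.

Lemma L2D f g : L2 f -> L2 g -> L2 (fun w => f w + g w).
Proof.
move=> Lf Lg; have [mf fi] := Lf; have [mg gi] := Lg.
split; first exact: measurable_funD.
have fgi := L2M_integrable Lf Lg.
have := integrableD measurableT (integrableD measurableT fi gi)
  (integrableZl measurableT 2 fgi).
apply: eq_integrable => // w _ /=.
by rewrite -!EFinD; congr (_%:E); ring.
Qed.

Lemma L2Z (c : R) f : L2 f -> L2 (fun w => c * f w).
Proof.
move=> [mf fi]; split; first exact: measurable_funM.
under eq_fun do rewrite exprMn EFinM.
exact: integrableZl.
Qed.

Lemma L2B f g : L2 f -> L2 g -> L2 (fun w => f w - g w).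
Proof.
move=> Lf Lg; have := L2D Lf (L2Z (-1) Lg).
by under eq_fun do rewrite mulN1r.
Qed.

Lemma L2_sum (I : Type) (s : seq I) (F : I -> T -> R) :
  (forall i, L2 (F i)) -> L2 (fun w => \sum_(i <- s) F i w).
Proof.
move=> iF; elim: s => [|i s IH].
  by under eq_fun do rewrite big_nil; exact: L2_cst.
by under eq_fun do rewrite big_cons; exact: L2D.
Qed.

Lemma ipC f g : ip f g = ip g f.
Proof. by apply: eq_Exp => w; rewrite mulrC. Qed.

Lemma ip_ge0 f : 0 <= ip f f.
Proof. by apply: Exp_ge0 => w; rewrite -expr2 sqr_ge0. Qed.

Lemma ipDl f g h : L2 f -> L2 g -> L2 h -> ip (fun w => f w + g w) h = ip f h + ip g h.
Proof.
move=> Lf Lg Lh; rewrite /ip -ExpD; [|exact: L2M_integrable..].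
by apply: eq_Exp => w; rewrite mulrDl.
Qed.

Lemma ipDr f g h : L2 f -> L2 g -> L2 h -> ip h (fun w => f w + g w) = ip h f + ip h g.
Proof. by move=> Lf Lg Lh; rewrite ipC ipDl// !(ipC h). Qed.

Lemma ipZl (c : R) f h : L2 f -> L2 h -> ip (fun w => c * f w) h = c * ip f h.
Proof.
move=> Lf Lh; rewrite /ip -ExpZ; last exact: L2M_integrable.
by apply: eq_Exp => w; rewrite mulrA.
Qed.

Lemma ipZr (c : R) f h : L2 f -> L2 h -> ip h (fun w => c * f w) = c * ip h f.
Proof. by move=> Lf Lh; rewrite ipC ipZl// ipC. Qed.

Lemma ip_suml (I : Type) (s : seq I) (F : I -> T -> R) h : (forall i, L2 (F i)) -> L2 h ->
  ip (fun w => \sum_(i <- s) F i w) h = \sum_(i <- s) ip (F i) h.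
Proof.
move=> LF Lh; rewrite -Exp_sum; last by move=> i; exact: L2M_integrable.
by apply: eq_Exp => w; rewrite mulr_suml.
Qed.

Lemma ip_sumr (I : Type) (s : seq I) (F : I -> T -> R) h : (forall i, L2 (F i)) -> L2 h ->
  ip h (fun w => \sum_(i <- s) F i w) = \sum_(i <- s) ip h (F i).
Proof.
by move=> LF Lh; rewrite ipC ip_suml//; apply: eq_bigr => i _; rewrite ipC.
Qed.

(** The common core of the Cauchy-Schwarz inequalities for random variables, for positive symmetric
    forms and for finite sums. *)
Lemma quadratic_discr (a b c : R) : 0 <= a -> (forall t, 0 <= a * t ^+ 2 + 2 * b * t + c) ->
  b ^+ 2 <= a * c.
Proof.
move=> a0 h; have [a1|a1] := eqVneq a 0.
  have [->|b1] := eqVneq b 0; first by rewrite a1 expr0n mul0r.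
  (* With a = 0 the polynomial is affine and takes the value -1 at this point. *)
  have := h (- (c + 1) / (2 * b)).
  have -> : a * (- (c + 1) / (2 * b)) ^+ 2 + 2 * b * (- (c + 1) / (2 * b)) + c = -1.
    by rewrite a1; field.
  by rewrite oppr_ge0 ler10.
have ap : 0 < a by rewrite lt_neqAle eq_sym a1.
have := h (- b / a).
have -> : a * (- b / a) ^+ 2 + 2 * b * (- b / a) + c = (a * c - b ^+ 2) / a by field.
by rewrite pmulr_lge0 ?invr_gt0// subr_ge0.
Qed.

Lemma ip_Cauchy_Schwarz f g : L2 f -> L2 g -> ip f g ^+ 2 <= ip f f * ip g g.
Proof.
move=> Lf Lg; apply: quadratic_discr (ip_ge0 f) _ => t.
have L1 := L2Z t Lf; have := ip_ge0 (fun w => t * f w + g w).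
rewrite ipDl ?ipDr ?ipZl ?ipZr//; [|exact: L2D..].
by rewrite (ipC g f); congr (_ <= _); ring.
Qed.

(** Only the product of the limits has to vanish, so one factor may stay fixed while the other tends
    to zero; [cvg_ip] uses it in all three combinations. *)
Lemma cvg_ip0 (f_ g_ : nat -> T -> R) (a b : R) :
  (forall n, L2 (f_ n)) -> (forall n, L2 (g_ n)) ->
  ip (f_ n) (f_ n) @[n --> \oo] --> a -> ip (g_ n) (g_ n) @[n --> \oo] --> b ->
  a * b = 0 -> ip (f_ n) (g_ n) @[n --> \oo] --> 0.
Proof.
move=> Lf Lg fa gb ab; apply: norm_cvg0.
apply: (@squeeze_cvgr _ _ _ _ (cst 0)
  (fun n => Num.sqrt (ip (f_ n) (f_ n) * ip (g_ n) (g_ n)))).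
- apply: nearW => n; rewrite normr_ge0/= -sqrtr_sqr ler_wsqrtr//.
  exact: ip_Cauchy_Schwarz.
- exact: cvg_cst.
- rewrite -[X in _ --> X]sqrtr0 -ab.
  by apply: (cvg_comp _ Num.sqrt (cvgM fa gb)); exact: sqrt_continuous.
Qed.

Lemma cvg_ip (f_ g_ : nat -> T -> R) f g :
  (forall n, L2 (f_ n)) -> (forall n, L2 (g_ n)) -> L2 f -> L2 g ->
  ip (fun w => f_ n w - f w) (fun w => f_ n w - f w) @[n --> \oo] --> 0 ->
  ip (fun w => g_ n w - g w) (fun w => g_ n w - g w) @[n --> \oo] --> 0 ->
  ip (f_ n) (g_ n) @[n --> \oo] --> ip f g.
Proof.
move=> Lf_ Lg_ Lf Lg f0 g0.
pose u n w := f_ n w - f w; pose v n w := g_ n w - g w.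
have Lu n : L2 (u n) by exact: L2B.
have Lv n : L2 (v n) by exact: L2B.
have e n : ip (f_ n) (g_ n) = ip (u n) (v n) + ip f (v n) + ip (u n) g + ip f g.
  have i1 : P.-integrable setT (EFin \o (fun w => u n w * v n w)) by exact: L2M_integrable.
  have i2 : P.-integrable setT (EFin \o (fun w => f w * v n w)) by exact: L2M_integrable.
  have i3 : P.-integrable setT (EFin \o (fun w => u n w * g w)) by exact: L2M_integrable.
  have i4 : P.-integrable setT (EFin \o (fun w => f w * g w)) by exact: L2M_integrable.
  have i12 : P.-integrable setT (EFin \o (fun w => u n w * v n w + f w * v n w)).
    exact: (integrableD measurableT i1 i2).
  have i123 : P.-integrable setT
      (EFin \o (fun w => u n w * v n w + f w * v n w + u n w * g w)).
    exact: (integrableD measurableT i12 i3).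
  rewrite /ip -(ExpD i1 i2) -(ExpD i12 i3) -(ExpD i123 i4).
  by apply: eq_Exp => w; rewrite /u /v; ring.
have -> : (fun n => ip (f_ n) (g_ n)) =
    (fun n => ip (u n) (v n) + ip f (v n) + ip (u n) g + ip f g) by apply/funext.
suff : ip (u n) (v n) + ip f (v n) + ip (u n) g + ip f g @[n --> \oo] -->
    0 + 0 + 0 + ip f g by rewrite !add0r.
apply: cvgD; last exact: cvg_cst.
apply: cvgD; first apply: cvgD.
- by apply: (@cvg_ip0 u v 0 0) => //; rewrite mul0r.
- by apply: (@cvg_ip0 (fun=> f) v (ip f f) 0) => //; [exact: cvg_cst|rewrite mulr0].
- by apply: (@cvg_ip0 u (fun=> g) 0 (ip g g)) => //; [exact: cvg_cst|rewrite mul0r].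
Qed.

End square_integrable.

(** * Change of variables and Gaussian expectations *)

Section law.
Context {R : realType} {d : measure_display} {T : measurableType d}.
Variable P : probability T R.
Local Notation mu := (@lebesgue_measure R).

Lemma Exp_law (d' : measure_display) (T' : measurableType d')
    (nu : {measure set T' -> \bar R}) (Y : T -> T')
    (f : T' -> R) :
  measurable_fun [set: T] Y ->
  (forall A, measurable A -> P (Y @^-1` A) = nu A) ->
  measurable_fun [set: T'] f ->
  nu.-integrable [set: T'] (EFin \o f) ->
  P.-integrable [set: T] (EFin \o (f \o Y)) /\
  Exp P (fun w => f (Y w)) = \int[nu]_x f x.
Proof.
move=> mY PY mf fi.
have mEf : measurable_fun [set: T'] (EFin \o f) by exact/measurable_EFinP.
have eqI (h : T' -> \bar R) :
    (\int[nu]_x h x = \int[pushforward P Y]_x h x)%E.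
  by apply: eq_measure_integral => A mA _; rewrite -PY.
have i : P.-integrable [set: T] ((EFin \o f) \o Y).
  apply/integrableP; split; first exact: measurableT_comp.
  case/integrableP : fi => _; apply: le_lt_trans.
  rewrite eqI ge0_integral_pushforward//; exact: measurableT_comp.
split => //; rewrite /Exp /Rintegral; congr fine.
by rewrite eqI integral_pushforward.
Qed.

(** Stated through the mean and variance of [Y] so that Dirac and normal laws share one formula.
    Degenerate laws do occur: a linear combination of two perfectly correlated variables may be
    constant, already when the two variables coincide. *)
Lemma gaussian_law_moments (Y : T -> R) : measurable_fun [set: T] Y ->
  gaussian_law P Y ->
  L2 P Y /\ forall th, Exp P (fun w => cos (Y w - Exp P Y + th)) =
                       cos th * expR (- var P Y / 2).
Proof.
move=> mY [m [s [[_ law]|[s0 law]]]].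
  have E (f : R -> R) : measurable_fun [set: R] f ->
      P.-integrable [set: T] (EFin \o (f \o Y)) /\ Exp P (fun w => f (Y w)) = f m.
    move=> mf; have mEf : measurable_fun [set: R] (EFin \o f) by exact/measurable_EFinP.
    have ifm : (dirac m : {measure set R -> \bar R}).-integrable [set: R] (EFin \o f).
      apply/integrableP; split => //.
      by rewrite integral_dirac ?diracT ?mul1e ?ltry//; exact: measurableT_comp.
    have [i ->] := @Exp_law _ R (dirac m) Y f mY law mf ifm.
    by split => //; rewrite /Rintegral integral_dirac// diracT mul1e.
  have EY : Exp P Y = m by have [] := E id (@measurable_id _ _ _).
  have VY : var P Y = 0.
    rewrite /var /mean EY.
    have [|_ ->] := E (fun x => (x - m) ^+ 2); last by rewrite subrr expr0n.
    by apply: measurable_funX; apply: measurable_funB.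
  split.
    split => //.
    have [|i _] := E (fun x => x ^+ 2); last exact: i.
    exact: measurable_funX.
  move=> th; rewrite EY VY oppr0 mul0r expR0 mulr1.
  have [|_ ->] := E (fun x => cos (x - m + th)); last by rewrite subrr add0r.
  apply: (@measurableT_comp _ _ _ _ _ _ (@cos R)).
    exact: continuous_measurable_fun (@continuous_cos R).
  by apply: measurable_funD => //; exact: measurable_funB.
have E (f : R -> R) C : measurable_fun [set: R] f ->
    (forall x, `|f x| <= C * (1 + (x - m) ^+ 2)) ->
    P.-integrable [set: T] (EFin \o (f \o Y)) /\
    Exp P (fun w => f (Y w)) = \int[mu]_x (f x * normal_pdf m s x).
  move=> mf fC.
  have [i e] := @integrable_normal_probP R m s f mf (integrable_sqr_normal_pdf s0 mf fC).
  have [i' e'] := @Exp_law _ (measurableTypeR R) (normal_prob m s) Y f mY law mf i.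
  by split => //; rewrite e' e.
have mB : measurable_fun [set: R] (fun x => x - m) by exact: measurable_funB.
have [iYm EYm] := E (fun x => x - m) 1 mB (ltac:(by move=> x; rewrite mul1r
  -(real_normK (num_real (x - m))); have := sqr_ge0 (`|x - m| - 1); nra)).
have [iV EV] := E (fun x => (x - m) ^+ 2) 1 (measurable_funX _ mB)
  (ltac:(by move=> x; rewrite mul1r ger0_norm ?sqr_ge0// lerDr)).
have LYm : L2 P (fun w => Y w - m).
  by split => //; exact: measurable_funB.
have LY : L2 P Y.
  have := L2D LYm (L2_cst P m).
  by under eq_fun do rewrite subrK.
have EY : Exp P Y = m.
  have : Exp P (fun w => Y w - m) = 0 by rewrite EYm normal_mean.
  rewrite ExpB; [|exact: L2_integrable|exact: L2_integrable (L2_cst P m)].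
  by rewrite Exp_cst => /subr0_eq.
have VY : var P Y = s ^+ 2 by rewrite /var /mean EY EV normal_variance.
split => // th; rewrite EY VY.
have [||_ ->] := E (fun x => cos (x - m + th)) 1.
- apply: (@measurableT_comp _ _ _ _ _ _ (@cos R)).
    exact: continuous_measurable_fun (@continuous_cos R).
  by apply: measurable_funD.
- move=> x; apply: (@le_trans _ _ 1); first by rewrite ler_norml cos_geN1 cos_le1.
  by rewrite mul1r lerDl sqr_ge0.
- have := @normal_cos R m s 1 th s0; rewrite expr1n mulr1 => <-.
  by under [RHS]eq_Rintegral do rewrite mul1r.
Qed.

End law.

(** * Density of trigonometric sums *)

Section trigonometric_sums.
Context {R : realType}.
Implicit Types (x y : R) (s : seq (R * R)) (g : R -> R).

(* Trigonometric polynomials are written with cas = cos + sin because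
   E[cas (t X) cas (s Y)] is then a single exponential for Gaussian (X, Y). *)
Definition cas x := cos x + sin x.

Definition cas_sum s y := \sum_(p <- s) p.1 * cas (p.2 * y).

Definition trigonometric g := exists s, g =1 cas_sum s.

Lemma cas0 : cas 0 = 1.
Proof. by rewrite /cas cos0 sin0 addr0. Qed.

Lemma cas_sum_cons (p : R * R) s y :
  cas_sum (p :: s) y = p.1 * cas (p.2 * y) + cas_sum s y.
Proof. exact: big_cons. Qed.

Lemma trigonometric_cst (c : R) : trigonometric (fun=> c).
Proof. by exists [:: (c, 0)] => y; rewrite /cas_sum big_seq1/= mul0r cas0 mulr1. Qed.

Lemma trigonometricD g1 g2 : trigonometric g1 -> trigonometric g2 ->
  trigonometric (fun y => g1 y + g2 y).
Proof.
move=> [s1 e1] [s2 e2]; exists (s1 ++ s2) => y.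
by rewrite e1 e2 /cas_sum big_cat.
Qed.

Lemma trigonometricZ (c : R) g : trigonometric g -> trigonometric (fun y => c * g y).
Proof.
move=> [s e]; exists [seq (c * p.1, p.2) | p <- s] => y.
by rewrite e /cas_sum big_map mulr_sumr; apply: eq_bigr => p _; rewrite /= mulrA.
Qed.

Lemma trigonometric_eq g1 g2 : g1 =1 g2 -> trigonometric g1 -> trigonometric g2.
Proof. by move=> e [s es]; exists s => y; rewrite -e. Qed.

Lemma trigonometric_cas (t : R) : trigonometric (fun y => cas (t * y)).
Proof. by exists [:: (1, t)] => y; rewrite /cas_sum big_seq1 mul1r. Qed.

(** The product is cos(a - b) + sin(a + b), and cosine and sine are the even and odd parts of
    [cas]. *)
Lemma casM (a b : R) : cas a * cas b =
  2^-1 * (cas (a - b) + cas (b - a) + cas (a + b) - cas (- (a + b))).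
Proof.
by rewrite /cas -(opprB a b) !cosN !sinN cosB sinB cosD sinD; field.
Qed.

Lemma trigonometricM g1 g2 : trigonometric g1 -> trigonometric g2 ->
  trigonometric (fun y => g1 y * g2 y).
Proof.
move=> [s1 e1] [s2 e2].
apply: (@trigonometric_eq (fun y => cas_sum s1 y * cas_sum s2 y)).
  by move=> y; rewrite e1 e2.
elim: s1 {g1 e1} => [|[c1 t1] s1 IH1].
  apply: trigonometric_eq (trigonometric_cst 0) => y.
  by rewrite /cas_sum big_nil mul0r.
apply: (@trigonometric_eq (fun y => c1 * (cas (t1 * y) * cas_sum s2 y) +
  cas_sum s1 y * cas_sum s2 y)).
  by move=> y; rewrite cas_sum_cons /=; ring.
apply: trigonometricD => //; apply: trigonometricZ.
elim: s2 {g2 e2 IH1} => [|[c2 t2] s2 IH2].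
  apply: trigonometric_eq (trigonometric_cst 0) => y.
  by rewrite /cas_sum big_nil mulr0.
apply: (@trigonometric_eq (fun y => c2 * (cas (t1 * y) * cas (t2 * y)) +
  cas (t1 * y) * cas_sum s2 y)).
  by move=> y; rewrite cas_sum_cons /=; ring.
apply: trigonometricD => //; apply: trigonometricZ.
apply: (@trigonometric_eq (fun y => 2^-1 * (cas ((t1 - t2) * y) + cas ((t2 - t1) * y)
   + cas ((t1 + t2) * y) + (-1) * cas (- (t1 + t2) * y)))).
  by move=> y; rewrite casM mulN1r !mulrBl mulNr !mulrDl.
do ?[exact: trigonometric_cas | apply: trigonometricZ | apply: trigonometricD].
Qed.

(** The phase [c] is what later places a zero of the sine at the endpoint of a half-line. *)
Lemma trigonometric_sin (b c : R) : trigonometric (fun y => sin (b * y + c)).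
Proof.
apply: (@trigonometric_eq (fun y =>
  (cos c / 2) * (cas (b * y) + (-1) * cas (- b * y)) +
  (sin c / 2) * (cas (b * y) + cas (- b * y)))).
  by move=> y; rewrite /cas !mulNr cosN sinN sinD; field.
do ?[exact: trigonometric_cas | apply: trigonometricZ | apply: trigonometricD].
Qed.

Lemma normr_cas x : `|cas x| <= 2.
Proof.
rewrite /cas; apply: (le_trans (ler_normD _ _)); rewrite -[2]/(1 + 1 : R).
by apply: lerD; rewrite ler_norml ?cos_geN1 ?cos_le1 ?sin_geN1 ?sin_le1.
Qed.

Lemma cas_sum_bounded s : exists C, forall y, `|cas_sum s y| <= C.
Proof.
exists (\sum_(p <- s) `|p.1| * 2) => y.
apply: (le_trans (ler_norm_sum _ _ _)); apply: ler_sum => p _.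
by rewrite normrM ler_wpM2l// normr_cas.
Qed.

Lemma measurable_cas : measurable_fun [set: R] cas.
Proof.
apply: measurable_funD; apply: continuous_measurable_fun.
  exact: continuous_cos.
exact: continuous_sin.
Qed.

Lemma measurable_cas_sum s : measurable_fun [set: R] (cas_sum s).
Proof.
apply: measurable_sum => p; apply: measurable_funM => //.
by apply: (measurableT_comp measurable_cas); exact: measurable_funM.
Qed.

End trigonometric_sums.

(** * Polynomial approximation of the sign *)

Section sign_approximation.
Context {R : realType}.
Implicit Types u y : R.

(* The iterates of this cubic drive every point of [-1, 1] to its sign. *)
Definition sgn_poly u := (3 * u - u ^+ 3) / 2.

Lemma sgn_poly_itv u : 0 <= u <= 1 -> u <= sgn_poly u <= 1.
Proof.
move=> /andP[u0 u1]; rewrite /sgn_poly -[u <= _]subr_ge0 -[_ <= 1]subr_ge0.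
rewrite (_ : _ - u = u * (1 - u) * (1 + u) / 2); last by field.
rewrite (_ : 1 - (3 * u - u ^+ 3) / 2 = (1 - u) ^+ 2 * (2 + u) / 2); last by field.
by rewrite !mulr_ge0 ?sqr_ge0 ?subr_ge0 ?addr_ge0.
Qed.

Lemma iter_sgn_poly_itv n u : 0 <= u <= 1 -> u <= iter n sgn_poly u <= 1.
Proof.
move=> u01; elim: n => [|n /andP[h1 h2]] /=; first by rewrite lexx; case/andP: u01.
have h : 0 <= iter n sgn_poly u <= 1.
  by rewrite h2 andbT; apply: le_trans h1; case/andP: u01.
by have /andP[h3 ->] := sgn_poly_itv h; rewrite andbT (le_trans h1).
Qed.

Lemma iter_sgn_polyN n u : iter n sgn_poly (- u) = - iter n sgn_poly u.
Proof. by elim: n => //= n ->; rewrite /sgn_poly; field. Qed.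

Lemma iter_sgn_poly_cvg_pos u : 0 < u <= 1 -> iter n sgn_poly u @[n --> \oo] --> (1 : R).
Proof.
move=> /andP[u0 u1]; have u01 : 0 <= u <= 1 by rewrite ltW.
(* One step maps the error 1 - v to (1 - v)(1 - v (1 + v) / 2), and the iterates v never fall below
   [u], so each step contracts it by a factor at most 1 - u / 2. *)
have b n : 1 - iter n sgn_poly u <= (1 - u / 2) ^+ n.
  elim: n => [|n IH]; first by rewrite expr0 /= lerBlDr lerDl ltW.
  have /andP[h1 h2] := iter_sgn_poly_itv n u01.
  rewrite exprSr /=; move: (iter n sgn_poly u) h1 h2 IH => v h1 h2 IH.
  have v0 : 0 <= v by apply: le_trans h1; exact: ltW.
  rewrite (_ : 1 - sgn_poly v = (1 - v) * (1 - v * (1 + v) / 2)); last by rewrite /sgn_poly; field.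
  have h3 : 1 - v * (1 + v) / 2 <= 1 - u / 2.
    by have := mulr_ge0 v0 v0; nra.
  have h4 : 0 <= 1 - v * (1 + v) / 2 by nra.
  by apply: ler_pM => //; rewrite subr_ge0.
have c0 : (1 - u / 2) ^+ n @[n --> \oo] --> (0 : R).
  by apply: cvg_expr; rewrite ger0_norm; lra.
apply: (@squeeze_cvgr _ _ _ _ (fun n => 1 - (1 - u / 2) ^+ n) (cst 1)).
- apply: nearW => n; have /andP[_ ->] := iter_sgn_poly_itv n u01.
  by rewrite andbT lerBlDr -lerBlDl.
- by rewrite -[X in _ --> X](subr0 1); apply: cvgB => //; exact: cvg_cst.
- exact: cvg_cst.
Qed.

(** The map v (1 + v) / 2 sends the limits -1, 0, 1 to 0, 0, 1, which turns the sign into the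
    indicator of the open positive half-line. *)
Definition pos_poly n u := let v := iter n sgn_poly u in v * (1 + v) / 2.

Lemma pos_poly_cvg u : `|u| <= 1 -> pos_poly n u @[n --> \oo] --> ((0 < u)%R%:R : R).
Proof.
have H (l : R) : iter n sgn_poly u @[n --> \oo] --> l ->
    pos_poly n u @[n --> \oo] --> l * (1 + l) / 2.
  move=> h; apply: cvgM; last exact: cvg_cst.
  by apply: cvgM => //; apply: cvgD => //; exact: cvg_cst.
move=> u1; have [u0|u0|u0] := ltgtP 0 u.
- rewrite [X in _ --> X](_ : _ = 1 * (1 + 1) / 2); last by rewrite /=; field.
  apply: H; apply: iter_sgn_poly_cvg_pos; rewrite u0/=.
  by apply: le_trans u1; exact: ler_norm.
- rewrite [X in _ --> X](_ : _ = -1 * (1 + -1) / 2); last by rewrite /=; field.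
  apply: H; rewrite (_ : (fun n => _) = (fun n => - iter n sgn_poly (- u))); last first.
    by apply/funext => n; rewrite iter_sgn_polyN opprK.
  apply: cvgN; apply: iter_sgn_poly_cvg_pos; rewrite oppr_gt0 u0/=.
  by apply: le_trans u1; rewrite -normrN; exact: ler_norm.
- rewrite [X in _ --> X](_ : _ = 0 * (1 + 0) / 2); last by rewrite /= !mul0r.
  apply: H; rewrite (_ : (fun n => _) = cst 0); first exact: cvg_cst.
  by apply/funext => n; rewrite -u0; elim: n => //= n ->; rewrite /sgn_poly; field.
Qed.

Lemma pos_poly_bounded n u : `|u| <= 1 -> `|pos_poly n u| <= 1.
Proof.
move=> u1; have : `|iter n sgn_poly u| <= 1.
  wlog u0 : u u1 / 0 <= u => [hw|].
    have [u0|u0] := leP 0 u; first exact: hw.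
    rewrite -normrN -iter_sgn_polyN; apply: hw; first by rewrite normrN.
    by rewrite oppr_ge0 ltW.
  have : 0 <= u <= 1 by rewrite u0/= -(ger0_norm u0).
  move=> /(iter_sgn_poly_itv n)/andP[h1 h2].
  by rewrite ger0_norm// (le_trans u0).
rewrite /pos_poly; move: (iter n sgn_poly u) => v; rewrite ler_norml => /andP[v1 v2].
by rewrite ler_norml; apply/andP; split; nra.
Qed.

Lemma trigonometric_pos_poly n (g : R -> R) :
  trigonometric g -> trigonometric (fun y => pos_poly n (g y)).
Proof.
move=> tg; have ti k : trigonometric (fun y => iter k sgn_poly (g y)).
  elim: k => //= k IH.
  apply: (@trigonometric_eq _ (fun y => 2^-1 * (3 * iter k sgn_poly (g y) + (-1) *
     (iter k sgn_poly (g y) * (iter k sgn_poly (g y) * iter k sgn_poly (g y)))))).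
    by move=> y; rewrite /sgn_poly; field.
  apply: trigonometricZ; apply: trigonometricD; apply: trigonometricZ => //.
  by do 2 ?apply: trigonometricM.
apply: (@trigonometric_eq _ (fun y => 2^-1 * (iter n sgn_poly (g y) *
    (1 + iter n sgn_poly (g y))))).
  by move=> y; rewrite /pos_poly; field.
apply: trigonometricZ; apply: trigonometricM => //; apply: trigonometricD => //.
exact: trigonometric_cst.
Qed.

End sign_approximation.

(** * Closure properties of approximable functions *)

Section trigonometric_density.
Context {R : realType} {d : measure_display} {T : measurableType d}.
Variable P : probability T R.
Variable Y : T -> R.
Hypothesis mY : measurable_fun [set: T] Y.
Implicit Types f g : R -> R.

Definition sqnorm (h : T -> R) := ip P h h.

(** Follows from positivity of the squared norm of h - k. It serves as a triangle inequality without
    square roots; its factor 2 is the reason for splitting errors into quarters. *)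
Lemma sqnormD_le (h k : T -> R) : L2 P h -> L2 P k ->
  sqnorm (fun w => h w + k w) <= 2 * sqnorm h + 2 * sqnorm k.
Proof.
move=> Lh Lk; have := ip_ge0 P (fun w => h w + (-1) * k w).
have Lk' := L2Z (-1) Lk.
rewrite /sqnorm !ipDl ?ipDr ?ipZl ?ipZr//; try exact: L2D.
rewrite (ipC P k h); lra.
Qed.

Lemma sqnormZ (c : R) (h : T -> R) : L2 P h -> sqnorm (fun w => c * h w) = c ^+ 2 * sqnorm h.
Proof. by move=> Lh; rewrite /sqnorm ipZl ?ipZr ?mulrA//; exact: L2Z. Qed.

Lemma L2_cas_sum s : L2 P (fun w => cas_sum s (Y w)).
Proof.
have [C hC] := cas_sum_bounded s.
apply: (@L2_bounded _ _ _ _ _ C) => //.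
exact: (measurableT_comp (measurable_cas_sum s) mY).
Qed.

(** Measurability and square integrability are included so that limits and the Dynkin induction
    carry them along with the approximation property. *)
Definition L2_approximable f := [/\ measurable_fun [set: R] f,
  L2 P (fun w => f (Y w)) &
  forall e : R, 0 < e -> exists s, sqnorm (fun w => f (Y w) - cas_sum s (Y w)) <= e].

Lemma L2_approximable_trigonometric g : trigonometric g -> L2_approximable g.
Proof.
move=> [s /funext ->]; split.
- exact: measurable_cas_sum.
- exact: L2_cas_sum.
- move=> e e0; exists s.
  rewrite (_ : (fun w => _) = (fun=> 0)); last by apply/funext => w; rewrite subrr.
  by rewrite /sqnorm /ip; under eq_Exp do rewrite mul0r; rewrite Exp_cst ltW.
Qed.

Lemma L2_approximable_closed f : measurable_fun [set: R] f ->
  L2 P (fun w => f (Y w)) ->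
  (forall e : R, 0 < e -> exists2 g, L2_approximable g &
    sqnorm (fun w => f (Y w) - g (Y w)) <= e) -> L2_approximable f.
Proof.
move=> mf Lf H; split => // e e0.
have e4 : 0 < e / 4 by rewrite divr_gt0.
have [g [mg Lg hg] fg] := H _ e4.
have [s gs] := hg _ e4; exists s.
have Ls := L2_cas_sum s.
have := sqnormD_le (L2B Lf Lg) (L2B Lg Ls).
rewrite (_ : (fun w => _ + _) = (fun w => f (Y w) - cas_sum s (Y w))); last first.
  by apply/funext => w; ring.
lra.
Qed.

Lemma L2_approximableD f g : L2_approximable f -> L2_approximable g ->
  L2_approximable (fun y => f y + g y).
Proof.
move=> [mf Lf hf] [mg Lg hg]; split; first exact: measurable_funD.
  exact: L2D.
move=> e e0; have e4 : 0 < e / 4 by rewrite divr_gt0.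
have [s1 h1] := hf _ e4; have [s2 h2] := hg _ e4; exists (s1 ++ s2).
have := sqnormD_le (L2B Lf (L2_cas_sum s1)) (L2B Lg (L2_cas_sum s2)).
rewrite (_ : (fun w => _ + _) =
  (fun w => f (Y w) + g (Y w) - cas_sum (s1 ++ s2) (Y w))); last first.
  by apply/funext => w; rewrite /cas_sum big_cat /=; ring.
lra.
Qed.

Lemma L2_approximableZ (c : R) f : L2_approximable f -> L2_approximable (fun y => c * f y).
Proof.
move=> [mf Lf hf].
have [->|c0] := eqVneq c 0.
  rewrite (_ : (fun y => 0 * f y) = fun=> 0); last by apply/funext => y; rewrite mul0r.
  by apply: L2_approximable_trigonometric; exact: trigonometric_cst.
split; first exact: measurable_funM.
  exact: L2Z.
move=> e e0; have c2 : 0 < c ^+ 2 by rewrite exprn_even_gt0.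
have [s hs] := hf (e / c ^+ 2) (divr_gt0 e0 c2).
have [s' es'] : trigonometric (fun y => c * cas_sum s y).
  by apply: trigonometricZ; exists s.
exists s'.
rewrite (_ : (fun w => _) = (fun w => c * (f (Y w) - cas_sum s (Y w)))); last first.
  by apply/funext => w; rewrite -es' mulrBr.
rewrite sqnormZ; last exact: L2B (L2_cas_sum s).
by rewrite mulrC -ler_pdivlMr.
Qed.

Lemma L2_approximable_sum (I : Type) (r : seq I) (F : I -> R -> R) :
  (forall i, L2_approximable (F i)) -> L2_approximable (fun y => \sum_(i <- r) F i y).
Proof.
move=> HF; elim: r => [|i r IH].
  under eq_fun do rewrite big_nil.
  by apply: L2_approximable_trigonometric; exact: trigonometric_cst.
by under eq_fun do rewrite big_cons; exact: L2_approximableD.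
Qed.

Lemma L2_approximable_dominated (f_ : nat -> R -> R) f (G : T -> R) :
  (forall n, L2_approximable (f_ n)) -> measurable_fun [set: R] f ->
  L2 P (fun w => f (Y w)) -> L2 P G ->
  (forall y, f_ n y @[n --> \oo] --> f y) ->
  (forall n w, `|f (Y w) - f_ n (Y w)| <= G w) -> L2_approximable f.
Proof.
move=> Vf_ mf Lf LG cf dG; apply: L2_approximable_closed => // e e0.
pose h n w := f (Y w) - f_ n (Y w).
have Lh n : L2 P (h n) by have [_ Lf_ _] := Vf_ n; exact: L2B.
suff : sqnorm (h n) @[n --> \oo] --> (0 : R).
  move=> /cvgrPdist_le/(_ _ e0)[N _ /(_ N (leqnn N))].
  rewrite /= sub0r normrN ger0_norm ?ip_ge0// => hN.
  by exists (f_ N).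
have mh n : measurable_fun [set: T] (fun w => (h n w ^+ 2)%:E).
  apply/measurable_EFinP; apply: measurable_funX.
  exact: L2_measurable (Lh n).
have ch : {ae P, forall w, [set: T] w -> (h n w ^+ 2)%:E @[n --> \oo] --> (0%:E : \bar R)}.
  apply: aeW => w _; apply: cvg_EFin; first exact: nearW.
  have hc : h n w @[n --> \oo] --> (0 : R).
    rewrite -[X in _ --> X](subrr (f (Y w))).
    by apply: cvgB; [exact: cvg_cst|exact: cf].
  rewrite (_ : _ \o _ = (fun n => h n w * h n w)); last first.
    by apply/funext => n; rewrite /= expr2.
  rewrite [X in _ --> X](_ : _ = 0 * 0 :> R); last by rewrite mul0r.
  exact: (cvgM hc hc).
have dh : {ae P, forall w n, [set: T] w -> (`|(h n w ^+ 2)%:E| <= (G w ^+ 2)%:E)%E}.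
  apply: aeW => w n _; rewrite /= lee_fin ger0_norm ?sqr_ge0//.
  have G0 : 0 <= G w by apply: le_trans (dG n w).
  by rewrite -(real_normK (num_real (h n w))) ler_sqr ?nnegrE// dG.
have m0 : measurable_fun [set: T] (fun=> 0%:E : \bar R) by [].
have [_ _ cv] := @dominated_convergence _ _ _ P _ measurableT _ _ _ mh m0 ch LG.2 dh.
have -> : (fun n => sqnorm (h n)) = fine \o (fun n => \int[P]_w (h n w ^+ 2)%:E)%E.
  by apply/funext => n; rewrite /= (L2_integralE (Lh n)).
by apply: fine_cvg; rewrite integral0_eq in cv.
Qed.

(** Constants are square integrable under a probability and can dominate. Every passage from sines
    to indicators of Borel sets goes through this closure. *)
Lemma L2_approximable_bounded (f_ : nat -> R -> R) f (C : R) :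
  (forall n, L2_approximable (f_ n)) -> (forall n y, `|f_ n y| <= C) ->
  (forall y, f_ n y @[n --> \oo] --> f y) -> L2_approximable f.
Proof.
move=> Vf_ bf cf.
have mf : measurable_fun [set: R] f.
  apply: (@measurable_fun_cvg _ _ _ [set: R] f_ f) => [n|y _]; last exact: cf.
  by have [] := Vf_ n.
have fC y : `|f y| <= C.
  have c : `|f_ n y| @[n --> \oo] --> `|f y| by exact: (cvg_norm (cf y)).
  rewrite -(cvg_lim _ c)//; apply: limr_le; first by apply/cvg_ex; exists `|f y|.
  exact: nearW.
apply: (@L2_approximable_dominated f_ f (fun=> C + C)) => //.
- apply: (@L2_bounded _ _ _ _ _ C) => //; exact: measurableT_comp mY.
- exact: L2_cst.
- by move=> n w; apply: (le_trans (ler_normB _ _)); exact: lerD.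
Qed.

End trigonometric_density.

(** * From half-lines to all square-integrable functions *)

Section trigonometric_density_L2.
Context {R : realType} {d : measure_display} {T : measurableType d}.
Variable P : probability T R.
Variable Y : T -> R.
Hypothesis mY : measurable_fun [set: T] Y.
Implicit Types f g : R -> R.
Local Notation approximable := (L2_approximable P Y).

Let normr_sin_le1 (x : R) : `|sin x| <= 1.
Proof. by rewrite ler_norml sin_geN1 sin_le1. Qed.

Lemma approximable_sin_pos (b c : R) :
  approximable (fun y => (0 < sin (b * y + c))%R%:R).
Proof.
apply: (@L2_approximable_bounded _ _ _ P Y mY
  (fun n y => pos_poly n (sin (b * y + c))) _ 1).
- move=> n; apply: L2_approximable_trigonometric => //.
  by apply: trigonometric_pos_poly; exact: trigonometric_sin.
- by move=> n y; exact: pos_poly_bounded (normr_sin_le1 _).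
- by move=> y; exact: pos_poly_cvg (normr_sin_le1 _).
Qed.

(* A half-line is the limit of the sets where a sine of growing period is positive. *)
Lemma approximable_ray (a : R) : approximable \1_(`]a, +oo[%classic).
Proof.
apply: (@L2_approximable_bounded _ _ _ P Y mY
  (fun n y => (0 < sin (n.+1%:R^-1 * y + - (n.+1%:R^-1 * a)))%R%:R) _ 1).
- by move=> n; exact: approximable_sin_pos.
- by move=> n y; case: ltP => _; rewrite /= ?normr1 ?normr0.
- move=> y; apply: cvg_near_cst.
  near=> n.
  have : `|y - a| < n%:R by near: n; exact: nbhs_infty_gtr.
  rewrite indicE -mulrN -mulrDr => yan.
  have n0 : 0 < n.+1%:R :> R by [].
  have yan' : `|y - a| < n.+1%:R by apply: (lt_trans yan); rewrite ltr_nat.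
  have pi1 : 1 < pi :> R by have := @pi_ge2 R; lra.
  have [ya|ya] := ltP a y.
    rewrite mem_set/= ?in_itv/= ?ya// (_ : (0 < _)%R = true)//.
    apply: sin_gt0_pi; rewrite mulr_gt0 ?invr_gt0 ?subr_gt0//=.
    apply: (lt_trans _ pi1); rewrite ltr_pdivrMl// mulr1.
    by apply: le_lt_trans yan'; exact: ler_norm.
  rewrite memNset/=; last by rewrite in_itv/= andbT; apply/negP; rewrite -leNgt.
  rewrite (_ : (0 < _)%R = false)//; apply/negbTE; rewrite -leNgt.
  rewrite -oppr_ge0 -sinN -mulrN opprB; apply: sin_ge0_pi.
  rewrite mulr_ge0 ?subr_ge0 ?invr_ge0//=.
  apply/ltW/(lt_trans _ pi1); rewrite ltr_pdivrMl// mulr1.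
  by apply: le_lt_trans yan'; rewrite distrC; exact: ler_norm.
Unshelve. all: by end_near. Qed.

Lemma approximable_cst (c : R) : approximable (fun=> c).
Proof.
by apply: L2_approximable_trigonometric => //; exact: trigonometric_cst.
Qed.

(** The pi-lambda theorem: open half-lines are stable under intersection and generate the Borel
    sets, while complements are linear operations on indicators and disjoint countable unions are
    bounded limits. *)
Lemma approximable_indic (A : set R) : measurable A -> approximable \1_A.
Proof.
move=> mA.
have E : @measurable _ R = <<s (@RGenOInfty.G R) >> := RGenOInfty.measurableE R.
apply: (@dynkin_induction _ R (@RGenOInfty.G R) (fun A => approximable \1_A) E _ _ _ _ _ A).
- move=> _ _ [a ->] [b ->]; exists (Num.max a b).
  by apply/seteqP; split => x /=; rewrite !in_itv/= !andbT gt_max => /andP.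
- rewrite (_ : \1_ _ = fun=> 1); first exact: approximable_cst.
  by apply/funext => x; rewrite indicT.
- by move=> _ [a ->]; exact: approximable_ray.
- move=> S mS VS.
  rewrite (_ : \1_ _ = fun x => 1 + (-1) * \1_S x).
    by apply: L2_approximableD => //; [exact: approximable_cst|exact: L2_approximableZ].
  apply/funext => x; rewrite !indicE in_setC.
  by case: (x \in S); rewrite /= ?mulr1 ?subrr ?mulr0 ?addr0.
- move=> F mF tF VF.
  (* By disjointness each partial sum is itself an indicator, which supplies the uniform bound 1. *)
  pose S n x := \sum_(i < n) \1_(F i) x : R.
  have S1 k n x : F k x -> S n x = (k < n)%N%:R.
    move=> Fkx; have F0 j : j != k -> \1_(F j) x = 0 :> R.
      move=> jk; rewrite indicE memNset// => Fjx.
      have := tF j k I I; rewrite -[_ = _]/(_) => h.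
      by move: jk; rewrite h ?eqxx//; exists x.
    rewrite /S; case: ltnP => kn.
      rewrite (bigD1 (Ordinal kn))//= indicE mem_set// big1 ?addr0// => j jk.
      by apply: F0; apply: contraNneq jk => jk; apply/eqP/val_inj.
    by rewrite big1// => j _; apply: F0; rewrite neq_ltn (leq_trans (ltn_ord j)).
  have S0 n x : ~ (\bigcup_k F k) x -> S n x = 0.
    move=> nF; rewrite /S big1// => j _; rewrite indicE memNset// => Fjx.
    by apply: nF; exists (val j).
  apply: (@L2_approximable_bounded _ _ _ P Y mY S _ 1).
  + by move=> n; apply: L2_approximable_sum => // i; exact: VF.
  + move=> n x; have [[k _ Fkx]|nF] := pselect ((\bigcup_k F k) x).
      by rewrite (S1 _ _ _ Fkx); case: ltnP => _; rewrite ?normr1 ?normr0.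
    by rewrite S0// normr0.
  + move=> x; have [[k _ Fkx]|nF] := pselect ((\bigcup_k F k) x); apply: cvg_near_cst.
      near=> n; rewrite (S1 _ _ _ Fkx) indicE mem_set; last by exists k.
      by rewrite (_ : (k < n)%N = true)//; near: n; exact: nbhs_infty_gt.
    by apply: nearW => n; rewrite S0// indicE memNset.
- by rewrite -E.
Unshelve. all: by end_near. Qed.

Import HBNNSimple.

(** Simple functions increase to [f], and the error lies between 0 and [f], so [f] itself is the
    dominating function. *)
Lemma approximable_ge0 f : measurable_fun [set: R] f -> (forall y, 0 <= f y) ->
  L2 P (fun w => f (Y w)) -> approximable f.
Proof.
move=> mf f0 Lf.
have mEf : measurable_fun [set: R] (EFin \o f) by exact/measurable_EFinP.
pose g n := nnsfun_approx measurableT mEf n.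
have gf n y : g n y <= f y.
  rewrite /g nnsfun_approxE -lee_fin; apply: le_approx => // x _.
  by rewrite /= lee_fin.
have g0 n y : 0 <= g n y by exact: fun_ge0.
apply: (@L2_approximable_dominated _ _ _ P Y mY (fun n => g n : R -> R) f (fun w => f (Y w))) => //.
- move=> n; rewrite (funext (fimfunEord (g n))).
  apply: L2_approximable_sum => // i; apply: L2_approximableZ => //.
  by apply: approximable_indic; exact: measurable_sfunP.
- move=> y; have f0' : forall x, [set: R] x -> (0 <= (EFin \o f) x)%E.
    by move=> x _; rewrite /= lee_fin.
  by have /fine_cvg := cvg_nnsfun_approx measurableT mEf f0' I (x := y).
- move=> n w; rewrite ger0_norm ?subr_ge0//.
  by rewrite lerBlDr lerDl.
Qed.

Lemma L2_approximable_L2 f : measurable_fun [set: R] f -> L2 P (fun w => f (Y w)) ->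
  approximable f.
Proof.
move=> mf Lf.
have mp : measurable_fun [set: R] (fun y => Num.max (f y) 0) by exact: measurable_maxr.
have mn : measurable_fun [set: R] (fun y => Num.max (- f y) 0).
  by apply: measurable_maxr => //; exact: measurableT_comp.
have dom (g : R -> R) : measurable_fun [set: R] g -> (forall y, `|g y| <= `|f y|) ->
    L2 P (fun w => g (Y w)).
  move=> mg gf; have mgY := measurableT_comp mg mY; split => //.
  apply: (le_integrable _ _ _ Lf.2) => //.
    by apply/measurable_EFinP; exact: measurable_funX.
  move=> w _ /=; rewrite lee_fin !ger0_norm ?sqr_ge0//.
  by rewrite -(real_normK (num_real (g _))) -(real_normK (num_real (f _))) ler_sqr ?nnegrE.
have -> : f = fun y => Num.max (f y) 0 + (-1) * Num.max (- f y) 0.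
  apply/funext => y; have /orP[f0|f0] := le_total 0 (f y).
    by rewrite max_l// max_r ?oppr_le0// mulr0 addr0.
  by rewrite max_r// max_l ?oppr_ge0// mulN1r opprK add0r.
apply: L2_approximableD => //; last apply: L2_approximableZ => //.
- apply: approximable_ge0 => //; first by move=> y; rewrite le_max lexx orbT.
  by apply: (dom (fun y => Num.max (f y) 0)) => // y; case: (leP (f y) 0) => _; rewrite ?normr0.
- apply: approximable_ge0 => //; first by move=> y; rewrite le_max lexx orbT.
  by apply: (dom (fun y => Num.max (- f y) 0)) => // y; case: (leP (- f y) 0) => _; rewrite ?normr0 ?normrN.
Qed.

End trigonometric_density_L2.

(** * The smallest eigenvalue of a symmetric matrix *)

Section smallest_eigenvalue.
Context {R : realType}.

(** Row vectors match [eigenvalue], whose eigenvectors satisfy [u *m A = a *: u]. *)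
Definition qform n (A : 'M[R]_n) (u v : 'rV[R]_n) : R := (u *m A *m v^T) 0 0.

Definition sqlen n (v : 'rV[R]_n) : R := \sum_i v 0 i ^+ 2.

Section forms.
Variables (n : nat).
Implicit Types (A B : 'M[R]_n) (u v w : 'rV[R]_n).

Lemma qformE A u v : qform A u v = \sum_i \sum_j u 0 i * v 0 j * A i j.
Proof.
rewrite /qform mxE exchange_big/=; apply: eq_bigr => j _.
rewrite !mxE mulr_suml; apply: eq_bigr => i _; ring.
Qed.

Lemma sqlen_ge0 v : 0 <= sqlen v.
Proof. by apply: sumr_ge0 => i _; exact: sqr_ge0. Qed.

Lemma sqlen_eq0 v : (sqlen v == 0) = (v == 0).
Proof.
rewrite psumr_eq0; last by move=> i _; exact: sqr_ge0.
apply/idP/eqP => [/allP h|->].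
  apply/rowP => i; rewrite mxE; apply/eqP.
  by have := h i; rewrite mem_index_enum sqrf_eq0 => /(_ isT).
by apply/allP => i _; rewrite /= mxE expr0n/= eqxx.
Qed.

Lemma dot_sqlen v : (v *m v^T) 0 0 = sqlen v.
Proof. by rewrite mxE; apply: eq_bigr => i _; rewrite mxE expr2. Qed.

Lemma qformDl A u v w : qform A (u + v) w = qform A u w + qform A v w.
Proof. by rewrite /qform !mulmxDl mxE. Qed.

Lemma qformDr A u v w : qform A w (u + v) = qform A w u + qform A w v.
Proof. by rewrite /qform linearD/= mulmxDr mxE. Qed.

Lemma qformZl A (c : R) u v : qform A (c *: u) v = c * qform A u v.
Proof. by rewrite /qform -!scalemxAl mxE. Qed.

Lemma qformZr A (c : R) u v : qform A u (c *: v) = c * qform A u v.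
Proof. by rewrite /qform linearZ/= -scalemxAr mxE. Qed.

Lemma qform_sym A u v : A^T = A -> qform A u v = qform A v u.
Proof.
move=> sA; rewrite /qform.
have -> : u *m A *m v^T = (v *m A *m u^T)^T by rewrite !trmx_mul trmxK sA mulmxA.
by rewrite mxE.
Qed.

Lemma qform_subscalar A (c : R) v : qform (A - c%:M) v v = qform A v v - c * sqlen v.
Proof. by rewrite /qform mulmxBr mulmxBl mul_mx_scalar -scalemxAl -dot_sqlen !mxE. Qed.

Lemma sqlenZ (c : R) v : sqlen (c *: v) = c ^+ 2 * sqlen v.
Proof. by rewrite /sqlen mulr_sumr; apply: eq_bigr => i _; rewrite mxE exprMn. Qed.

Lemma qform_Cauchy_Schwarz A u v : A^T = A -> (forall w, 0 <= qform A w w) ->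
  qform A u v ^+ 2 <= qform A u u * qform A v v.
Proof.
move=> sA pA; apply: quadratic_discr (pA u) _ => t.
have := pA (t *: u + v).
rewrite !qformDl !qformDr !qformZl !qformZr (qform_sym v u sA).
by congr (_ <= _); ring.
Qed.

Lemma sum_Cauchy_Schwarz (a b : 'I_n -> R) :
  (\sum_i a i * b i) ^+ 2 <= (\sum_i a i ^+ 2) * (\sum_i b i ^+ 2).
Proof.
apply: quadratic_discr; first by apply: sumr_ge0 => i _; exact: sqr_ge0.
move=> t; rewrite (_ : _ + _ = \sum_i (t * a i + b i) ^+ 2).
  by apply: sumr_ge0 => i _; exact: sqr_ge0.
rewrite -mulrA mulr_suml mulr_suml mulr_sumr -!big_split/=.
by apply: eq_bigr => i _; ring.
Qed.

Lemma sqlen_mulmx_le A : exists2 D : R, 0 <= D & forall v, sqlen (v *m A) <= D * sqlen v.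
Proof.
(* The squared Frobenius norm, from Cauchy-Schwarz applied to each column. *)
exists (\sum_j \sum_i A i j ^+ 2).
  by apply: sumr_ge0 => j _; apply: sumr_ge0 => i _; exact: sqr_ge0.
move=> v; rewrite /sqlen mulr_suml; apply: ler_sum => j _; rewrite mxE mulrC.
exact: sum_Cauchy_Schwarz.
Qed.

(** With w = v B, Cauchy-Schwarz for the form B gives |w|^4 = B(v, w)^2 <= B(v, v) B(w, w) <= (C +
    1) |w|^2 B(v, v), while invertibility gives |v|^2 <= (D + 1) |w|^2. This quantitative bound
    takes the place of compactness of the unit sphere. *)
Lemma unitmx_qform_lb B : B^T = B -> (forall w, 0 <= qform B w w) -> B \in unitmx ->
  exists2 c : R, 0 < c & forall v, c * sqlen v <= qform B v v.
Proof.
move=> sB pB uB; have [D D0 hD] := sqlen_mulmx_le (invmx B).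
have [C C0 hC] := sqlen_mulmx_le B.
have D1 : 0 < D + 1 by rewrite ltr_wpDl.
have C1 : 0 < C + 1 by rewrite ltr_wpDl.
exists ((D + 1) * (C + 1))^-1; first by rewrite invr_gt0 mulr_gt0.
move=> v; rewrite mulrC ler_pdivrMr ?mulr_gt0//.
pose w := v *m B.
have vw : sqlen v <= (D + 1) * sqlen w.
  rewrite -[v in X in X <= _](mulmxK uB) -/w; apply: (le_trans (hD w)).
  by rewrite ler_wpM2r ?sqlen_ge0// lerDl.
have qw : qform B w w <= (C + 1) * sqlen w.
  rewrite /qform mxE.
  apply: (@le_trans _ _ (\sum_j ((w *m B) 0 j ^+ 2 + w 0 j ^+ 2))).
    apply: ler_sum => j _; rewrite [w^T _ _]mxE.
    have := sqr_ge0 ((w *m B) 0 j - w 0 j).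
    have := sqr_ge0 ((w *m B) 0 j + w 0 j); lra.
  rewrite big_split/= mulrDl mul1r lerD2r; exact: hC.
have cs := qform_Cauchy_Schwarz v w sB pB.
have vBw : qform B v w = sqlen w by rewrite /qform -/w dot_sqlen.
rewrite vBw in cs.
have [w0|w0] := eqVneq (sqlen w) 0.
  by apply: (le_trans vw); rewrite w0 mulr0 !mulr_ge0 ?pB// ltW.
have wp : 0 < sqlen w by rewrite lt_neqAle eq_sym w0 sqlen_ge0.
have h : sqlen w <= (C + 1) * qform B v v.
  rewrite -(ler_pM2r wp) -expr2; apply: (le_trans cs).
  by rewrite [_ * qform B v v]mulrC -mulrA ler_wpM2l// pB.
by apply: (le_trans vw); rewrite [leRHS]mulrCA ler_pM2l// [leRHS]mulrC.
Qed.

End forms.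

(** The infimum m of the form on the unit sphere is an eigenvalue. Otherwise A - m I would be
    invertible and positive semidefinite, hence bounded below by some c > 0, and the form would stay
    above m + c on the sphere. So [lambda_min A] is at most m. *)
Lemma lambda_min_le_qform n (A : 'M[R]_n) (v : 'rV[R]_n) : A^T = A ->
  (forall w, 0 <= qform A w w) -> lambda_min A * sqlen v <= qform A v v.
Proof.
move=> sA pA.
(* Size 0 has no unit vector; there the left-hand side vanishes whatever [lambda_min] is. *)
case: n A v sA pA => [|n] A v sA pA.
  by rewrite /sqlen big_ord0 mulr0; exact: pA.
pose S := [set x : R | exists2 u : 'rV[R]_n.+1, sqlen u = 1 & x = qform A u u].
have lbS : has_lbound S by exists 0 => _ [u _ ->]; exact: pA.
have S0 : S !=set0.
  exists (qform A (delta_mx 0 0) (delta_mx 0 0)), (delta_mx 0 0) => //.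
  rewrite /sqlen (bigD1 ord0)//= mxE eqxx big1 ?addr0 ?expr1n// => i i0.
  by rewrite mxE/= (negbTE i0) expr0n.
pose m := inf S.
have mq u : m * sqlen u <= qform A u u.
  have [->|u0] := eqVneq u 0.
    rewrite (_ : sqlen 0 = 0) ?mulr0 ?pA//; apply/eqP; by rewrite sqlen_eq0.
  have up : 0 < sqlen u by rewrite lt_neqAle eq_sym sqlen_eq0 u0 sqlen_ge0.
  have : S (qform A ((Num.sqrt (sqlen u))^-1 *: u) ((Num.sqrt (sqlen u))^-1 *: u)).
    exists ((Num.sqrt (sqlen u))^-1 *: u) => //.
    by rewrite sqlenZ exprVn sqr_sqrtr ?sqlen_ge0// mulVf// gt_eqF.
  move=> /(ge_inf lbS); rewrite qformZl qformZr mulrA -expr2 exprVn.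
  by rewrite sqr_sqrtr ?sqlen_ge0// mulrC ler_pdivlMr.
pose B := A - m%:M.
have sB : B^T = B by rewrite /B linearB/= sA tr_scalar_mx.
have pB w : 0 <= qform B w w by rewrite qform_subscalar subr_ge0.
have em : eigenvalue A m.
  apply: contraT => nem.
  have uB : B \in unitmx.
    by rewrite -row_free_unit -kermx_eq0; move: nem; rewrite /eigenvalue negbK.
  have [c c0 hc] := unitmx_qform_lb sB pB uB.
  have : m + c <= m.
    rewrite {2}/m; apply: lb_le_inf => // _ [u u1 ->].
    by have := hc u; rewrite qform_subscalar u1 !mulr1; lra.
  by rewrite gerDl leNgt c0.
have lbE : has_lbound [set a : R | eigenvalue A a].
  exists 0 => a /= /eigenvalueP[u ua u0].
  have up : 0 < sqlen u by rewrite lt_neqAle eq_sym sqlen_eq0 u0 sqlen_ge0.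
  have := pA u; rewrite /qform ua -scalemxAl mxE dot_sqlen.
  by rewrite pmulr_lge0.
apply: (le_trans _ (mq v)); rewrite ler_wpM2r ?sqlen_ge0//.
exact: ge_inf.
Qed.

Lemma lambda_min_ge0 n (A : 'M[R]_n) : (forall w, 0 <= qform A w w) -> 0 <= lambda_min A.
Proof.
move=> pA; rewrite /lambda_min.
(* An empty set of eigenvalues, as in size 0, has infimum 0 by convention. *)
have [->|/set0P E0] := eqVneq [set a : R | eigenvalue A a] set0; first by rewrite inf0.
apply: lb_le_inf => // a /= /eigenvalueP[u ua u0].
have up : 0 < sqlen u by rewrite lt_neqAle eq_sym sqlen_eq0 u0 sqlen_ge0.
by have := pA u; rewrite /qform ua -scalemxAl mxE dot_sqlen pmulr_lge0.
Qed.

End smallest_eigenvalue.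

(** * Hadamard powers and the exponential series *)

Section exponential_series.
Context {R : realType}.

(** The constant term is left out because a covariance subtracts the product of the means, so only
    powers k >= 1 of the correlations remain. *)
Lemma cvg_expR_sub1 (x : R) :
  \sum_(k < N) x ^+ k.+1 / (k.+1)`!%:R @[N --> \oo] --> expR x - 1.
Proof.
have h : series (exp_coeff x) n.+1 @[n --> \oo] --> expR x.
  by rewrite (cvg_shiftS (series (exp_coeff x))); exact: is_cvg_series_exp_coeff.
have -> : (fun N => \sum_(k < N) x ^+ k.+1 / (k.+1)`!%:R) =
    (fun N => series (exp_coeff x) N.+1 - 1).
  apply/funext => N; rewrite /series/= big_nat_recl// /exp_coeff/= expr0 fact0 divr1.
  by rewrite addrAC subrr add0r big_mkord.
by apply: cvgB => //; exact: cvg_cst.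
Qed.

Lemma cvg_Rsum (I : Type) (r : seq I) (F : nat -> I -> R) (l : I -> R) :
  (forall i, F n i @[n --> \oo] --> l i) ->
  \sum_(i <- r) F n i @[n --> \oo] --> \sum_(i <- r) l i.
Proof.
move=> H; elim: r => [|i r IH].
  by rewrite big_nil; under eq_fun do rewrite big_nil; exact: cvg_cst.
by rewrite big_cons; under eq_fun do rewrite big_cons; exact: cvgD.
Qed.

Variables (n : nat) (rho : 'I_n -> 'I_n -> R) (lam : R).

(* Expanding exp turns the claim into one inequality for each Hadamard power of rho. *)
Lemma exp_kernel_ge (s : 'I_n -> seq (R * R)) :
  (forall (k : nat) (w : 'I_n -> R),
    lam * \sum_i w i ^+ 2 <= \sum_i \sum_j w i * w j * rho i j ^+ k.+1) ->
  lam * (\sum_i \sum_(p <- s i) \sum_(q <- s i) p.1 * q.1 * (expR (p.2 * q.2) - 1)) <=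
  \sum_i \sum_j \sum_(p <- s i) \sum_(q <- s j)
     p.1 * q.1 * (expR (rho i j * (p.2 * q.2)) - 1).
Proof.
move=> H.
pose e N x : R := \sum_(k < N) x ^+ k.+1 / (k.+1)`!%:R.
pose K i j (phi : R -> R) := \sum_(p <- s i) \sum_(q <- s j) p.1 * q.1 * phi (p.2 * q.2).
have cK i j (c : R) : K i j (fun x => e N (c * x)) @[N --> \oo] -->
    K i j (fun x => expR (c * x) - 1).
  apply: cvg_Rsum => p; apply: cvg_Rsum => q.
  by apply: cvgM; [exact: cvg_cst|exact: cvg_expR_sub1].
(* Each power of p.2 * q.2 is a product of powers, so the double sum over frequencies factors into
   these moments, which become the test vector for the Hadamard power of exponent k + 1. *)
pose w k i : R := \sum_(p <- s i) p.1 * p.2 ^+ k.+1.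
have KE N i j (c : R) : K i j (fun x => e N (c * x)) =
    \sum_(k < N) ((k.+1)`!%:R^-1 * (w k i * w k j * c ^+ k.+1)).
  rewrite /K /e.
  under eq_bigr => p _ do under eq_bigr => q _ do rewrite mulr_sumr.
  under eq_bigr => p _ do rewrite exchange_big/=.
  rewrite exchange_big/=; apply: eq_bigr => k _.
  rewrite /w mulr_suml mulr_suml mulr_sumr; apply: eq_bigr => p _.
  rewrite mulr_sumr mulr_suml mulr_sumr; apply: eq_bigr => q _.
  by rewrite !exprMn; ring.
pose L N := lam * \sum_i K i i (fun x => e N (1 * x)).
pose U N := \sum_i \sum_j K i j (fun x => e N (rho i j * x)).
have LU N : L N <= U N.
  rewrite /L /U.
  under eq_bigr => i _ do rewrite KE.
  under [leRHS]eq_bigr => i _ do under eq_bigr => j _ do rewrite KE.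
  under [leRHS]eq_bigr => i _ do rewrite exchange_big/=.
  rewrite exchange_big/= [leRHS]exchange_big/= mulr_sumr.
  apply: ler_sum => k _.
  under [leRHS]eq_bigr => i _ do rewrite -mulr_sumr.
  rewrite -!mulr_sumr mulrCA ler_wpM2l ?invr_ge0//.
  apply: le_trans (H k (w k)); rewrite le_eqVlt; apply/orP; left; apply/eqP.
  by congr (_ * _); apply: eq_bigr => i _; rewrite expr1n mulr1 expr2.
have cL : L N @[N --> \oo] --> lam * \sum_i K i i (fun x => expR (1 * x) - 1).
  by apply: cvgM; [exact: cvg_cst|apply: cvg_Rsum => i; exact: cK].
have cU : U N @[N --> \oo] --> \sum_i \sum_j K i j (fun x => expR (rho i j * x) - 1).
  by apply: cvg_Rsum => i; apply: cvg_Rsum => j; exact: cK.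
rewrite [leLHS](_ : _ = lam * \sum_i K i i (fun x => expR (1 * x) - 1)); last first.
  congr (_ * _); apply: eq_bigr => i _; apply: eq_bigr => p _; apply: eq_bigr => q _.
  by rewrite mul1r.
rewrite -(cvg_lim _ cL)// -[leRHS](cvg_lim _ cU)//.
apply: ler_lim; [by apply/cvg_ex; eexists; exact: cL|by apply/cvg_ex; eexists; exact: cU|].
exact: nearW.
Qed.

End exponential_series.

(** * Covariances and Schur products *)

Section covariance.
Context {R : realType} {d : measure_display} {T : measurableType d}.
Variable P : probability T R.
Implicit Types f g h : T -> R.

Definition cov f g : R := ip P f g - Exp P f * Exp P g.

Lemma Exp_ip f : Exp P f = ip P f (fun=> 1).
Proof. by apply: eq_Exp => w; rewrite mulr1. Qed.

Lemma ip_center f : L2 P f ->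
  ip P (fun w => f w - Exp P f) (fun w => f w - Exp P f) = cov f f.
Proof.
move=> Lf; set c := Exp P f.
have L1 := L2_cst P 1.
have Lc := L2Z (- c) L1.
rewrite (_ : (fun w => f w - c) = (fun w => f w + - c * 1)); last first.
  by apply/funext => w; rewrite mulr1.
have LD := L2D Lf Lc.
rewrite ipDl// !ipDr// ipZl// !ipZr// ipZl// (ipC P (fun=> 1) f) -Exp_ip -/c.
have -> : ip P (fun=> 1) (fun=> 1) = 1 by rewrite -Exp_ip Exp_cst.
by rewrite /cov -/c; ring.
Qed.

Lemma ip_linear_comb (a b : R) f g : L2 P f -> L2 P g ->
  ip P (fun w => a * f w + b * g w) (fun w => a * f w + b * g w) =
  a ^+ 2 * ip P f f + b ^+ 2 * ip P g g + 2 * (a * b * ip P f g).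
Proof.
move=> Lf Lg; have La := L2Z a Lf; have Lb := L2Z b Lg; have LZ := L2D La Lb.
rewrite ipDl// !ipDr// !ipZl// !ipZr// (ipC P g f); ring.
Qed.

Lemma ip_sum_sum (I : Type) (r : seq I) (F : I -> T -> R) : (forall i, L2 P (F i)) ->
  ip P (fun w => \sum_(i <- r) F i w) (fun w => \sum_(i <- r) F i w) =
  \sum_(i <- r) \sum_(j <- r) ip P (F i) (F j).
Proof.
move=> LF; rewrite ip_suml//; last exact: L2_sum.
by apply: eq_bigr => i _; rewrite ip_sumr.
Qed.

Lemma ip_sum_cov n (F : 'I_n -> T -> R) : (forall i, L2 P (F i)) ->
  ip P (fun w => \sum_i F i w) (fun w => \sum_i F i w) =
  \sum_i \sum_j cov (F i) (F j) + (\sum_i Exp P (F i)) ^+ 2.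
Proof.
move=> LF; rewrite ip_sum_sum// expr2 mulr_suml -big_split/=.
apply: eq_bigr => i _; rewrite mulr_sumr -big_split/=.
by apply: eq_bigr => j _; rewrite /cov subrK.
Qed.

(** The right-hand side involves only means and variances of single terms, which the marginals
    determine. The factor n is Cauchy-Schwarz against the all-ones vector, applied pointwise to the
    centred terms. *)
Lemma ip_sum_le n (F : 'I_n -> T -> R) : (forall i, L2 P (F i)) ->
  ip P (fun w => \sum_i F i w) (fun w => \sum_i F i w) <=
  n%:R * (\sum_i cov (F i) (F i)) + (\sum_i Exp P (F i)) ^+ 2.
Proof.
move=> LF.
have LS := L2_sum (index_enum 'I_n) LF.
have ES : Exp P (fun w => \sum_i F i w) = \sum_i Exp P (F i).
  by rewrite Exp_sum// => i; exact: L2_integrable.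
rewrite -lerBlDr -ES.
have := ip_center LS; rewrite /cov -expr2 => <-; rewrite ES.
have LG i : L2 P (fun w => F i w - Exp P (F i)) by apply: L2B => //; exact: L2_cst.
rewrite -(eq_bigr _ (fun i _ => ip_center (LF i))).
have iG i : P.-integrable setT
    (EFin \o (fun w => (F i w - Exp P (F i)) * (F i w - Exp P (F i)))).
  exact: (L2M_integrable (LG i) (LG i)).
rewrite /ip -(Exp_sum _ iG) -ExpZ; last exact: integrable_RsumP.
apply: le_Rintegral => //.
- have LD : L2 P (fun w => \sum_i F i w - \sum_i Exp P (F i)).
    by apply: L2B => //; exact: L2_cst.
  exact: (L2M_integrable LD LD).
- exact: (integrableZl measurableT _ (integrable_RsumP _ iG)).
- move=> w _; rewrite -sumrB -expr2.
  have := sum_Cauchy_Schwarz (fun i => F i w - Exp P (F i)) (fun=> 1).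
  rewrite (eq_bigr (fun i => F i w - Exp P (F i))); last by move=> i _; rewrite mulr1.
  move=> h; apply: (le_trans h); rewrite mulrC.
  rewrite [X in X * _](_ : _ = n%:R).
    by under eq_bigr do rewrite expr2.
  by under eq_bigr do rewrite expr1n; rewrite sumr_const card_ord.
Qed.

Lemma cvg_cov (f_ g_ : nat -> T -> R) f g :
  (forall k, L2 P (f_ k)) -> (forall k, L2 P (g_ k)) -> L2 P f -> L2 P g ->
  sqnorm P (fun w => f_ k w - f w) @[k --> \oo] --> (0 : R) ->
  sqnorm P (fun w => g_ k w - g w) @[k --> \oo] --> (0 : R) ->
  cov (f_ k) (g_ k) @[k --> \oo] --> cov f g.
Proof.
move=> Lf_ Lg_ Lf Lg cf cg.
have L1 := L2_cst P 1.
have c1 : ip P (fun w => 1 - 1) (fun w => 1 - 1) @[_ --> \oo] --> (0 : R).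
  rewrite (_ : ip P _ _ = 0); first exact: cvg_cst.
  by rewrite /ip; under eq_Exp do rewrite subrr mulr0; rewrite Exp_cst.
apply: cvgB; first exact: cvg_ip.
rewrite !Exp_ip; under eq_fun do rewrite !Exp_ip.
by apply: cvgM; apply: (@cvg_ip _ _ _ P _ (fun=> fun=> 1)).
Qed.

(* Schur products: a Gram matrix multiplies a positive form pointwise under the expectation. *)
Lemma hadamard_pow_ge n (Y : 'I_n -> T -> R) (lam : R) :
  (forall i, L2 P (Y i)) -> (forall i, ip P (Y i) (Y i) = 1) ->
  (forall w : 'I_n -> R, lam * \sum_i w i ^+ 2 <=
     \sum_i \sum_j w i * w j * ip P (Y i) (Y j)) ->
  forall k (w : 'I_n -> R), lam * \sum_i w i ^+ 2 <=
     \sum_i \sum_j w i * w j * ip P (Y i) (Y j) ^+ k.+1.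
Proof.
move=> LY Y1 H; elim=> [|k IH] w; first exact: H.
have iM i j : P.-integrable setT (EFin \o (fun x => Y i x * Y j x)).
  exact: L2M_integrable.
have iZ (c : R) i j : P.-integrable setT (EFin \o (fun x => c * (Y i x * Y j x))).
  exact: (integrableZl measurableT c (iM i j)).
have -> : \sum_i \sum_j w i * w j * ip P (Y i) (Y j) ^+ k.+2 =
    Exp P (fun x => \sum_i \sum_j (w i * w j * ip P (Y i) (Y j) ^+ k.+1) * (Y i x * Y j x)).
  rewrite Exp_sum; last by move=> i; exact: integrable_RsumP.
  apply: eq_bigr => i _; rewrite Exp_sum//; apply: eq_bigr => j _.
  by rewrite ExpZ// exprSr mulrA.
(* The unit diagonal lets w_i^2 be read as the expectation of (w_i Y_i)^2, so that the induction
   hypothesis can be applied pointwise to the random weights w_i Y_i. *)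
have -> : lam * \sum_i w i ^+ 2 =
    Exp P (fun x => \sum_i (lam * w i ^+ 2) * (Y i x * Y i x)).
  rewrite Exp_sum// mulr_sumr; apply: eq_bigr => i _.
  by rewrite ExpZ// [Exp _ _]Y1 mulr1.
apply: le_Rintegral => //.
- exact: integrable_RsumP.
- by apply: integrable_RsumP => i; exact: integrable_RsumP.
- move=> x _; have := IH (fun i => w i * Y i x); rewrite mulr_sumr.
  rewrite (eq_bigr (fun i => lam * w i ^+ 2 * (Y i x * Y i x))); last first.
    by move=> i _; ring.
  move=> h; apply: (le_trans h); rewrite le_eqVlt; apply/orP; left; apply/eqP.
  by apply: eq_bigr => i _; apply: eq_bigr => j _; ring.
Qed.

End covariance.

(** * Covariance inequality for functions of pairwise Gaussian variables *)

Section standard_gaussian_family.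
Context {R : realType} {d : measure_display} {T : measurableType d}.
Variable P : probability T R.
Variables (n : nat) (X : 'I_n -> T -> R).
Hypothesis mX : forall i, measurable_fun [set: T] (X i).
Hypothesis vX : forall i, 0 < var P (X i).
Hypothesis gX : forall i j, bivariate_gaussian P (X i) (X j).

Definition standardize i w := (X i w - mean P (X i)) / Num.sqrt (var P (X i)).
Local Notation Y := standardize.
Let sd i := Num.sqrt (var P (X i)).

Let sd_neq0 i : sd i != 0.
Proof. by rewrite gt_eqF// sqrtr_gt0. Qed.

Lemma standardizeK i w : mean P (X i) + Num.sqrt (var P (X i)) * Y i w = X i w.
Proof. by rewrite /standardize mulrC divfK ?sd_neq0// addrC subrK. Qed.

Lemma L2_gaussian i : L2 P (X i).
Proof.
have g : gaussian_law P (X i).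
  have := gX i i 1 0; rewrite (_ : (fun w => _) = X i)//.
  by apply/funext => w; rewrite mul1r mul0r addr0.
by have [] := gaussian_law_moments (mX i) g.
Qed.

Lemma measurable_standardize i : measurable_fun [set: T] (Y i).
Proof. by apply: measurable_funM => //; exact: measurable_funB. Qed.

Let YE i : Y i = fun w => (sd i)^-1 * (X i w + - mean P (X i)).
Proof. by apply/funext => w; rewrite /standardize mulrC. Qed.

Lemma L2_standardize i : L2 P (Y i).
Proof. by rewrite YE; apply: L2Z; apply: L2D (L2_gaussian i) _; exact: L2_cst. Qed.

Lemma ip_standardize i : ip P (Y i) (Y i) = 1.
Proof.
have L : L2 P (fun w => X i w - mean P (X i)).
  by apply: L2B (L2_gaussian i) _; exact: L2_cst.
rewrite YE ipZl ?ipZr//; last exact: L2Z.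
rewrite mulrA -expr2 exprVn sqr_sqrtr ?ltW//.
by rewrite (_ : ip P _ _ = var P (X i)) ?mulVf ?gt_eqF.
Qed.

Lemma Exp_cos_standardize i j (t s th : R) :
  Exp P (fun w => cos (t * Y i w + s * Y j w + th)) =
  cos th * expR (- (t ^+ 2 + s ^+ 2 + 2 * (t * s * ip P (Y i) (Y j))) / 2).
Proof.
pose W w := t / sd i * X i w + s / sd j * X j w.
have Li := L2_gaussian i; have Lj := L2_gaussian j.
have mW : measurable_fun [set: T] W.
  by apply: measurable_funD; exact: measurable_funM.
have [_ HW] := gaussian_law_moments mW (gX i j (t / sd i) (s / sd j)).
have EW : Exp P W = t / sd i * mean P (X i) + s / sd j * mean P (X j).
  rewrite /W ExpD; [|exact: L2_integrable (L2Z _ _)..].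
  by rewrite !ExpZ//; exact: L2_integrable.
have WE w : W w - Exp P W = t * Y i w + s * Y j w.
  rewrite EW /W !YE.
  move: (mean P (X i)) (mean P (X j)) (X i w) (X j w) (sd_neq0 i) (sd_neq0 j).
  by move: (sd i) (sd j) => a b c e x y a0 b0; field; rewrite a0 b0.
have VW : var P W = t ^+ 2 + s ^+ 2 + 2 * (t * s * ip P (Y i) (Y j)).
  have LYi := L2_standardize i; have LYj := L2_standardize j.
  rewrite /var (_ : Exp P _ = ip P (fun w => t * Y i w + s * Y j w)
    (fun w => t * Y i w + s * Y j w)); last first.
    by apply: eq_Exp => w; rewrite /mean WE expr2.
  have lin (x y z : R) : x = 1 -> y = 1 ->
      t ^+ 2 * x + s ^+ 2 * y + 2 * (t * s * z) = t ^+ 2 + s ^+ 2 + 2 * (t * s * z).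
    by move=> -> ->; rewrite !mulr1.
  exact: etrans (ip_linear_comb t s LYi LYj) (lin _ _ _ (ip_standardize i) (ip_standardize j)).
by rewrite -VW -HW; apply: eq_Exp => w; rewrite WE.
Qed.

(** The product is cos(t Y_i - s Y_j) + sin(t Y_i + s Y_j). The sine, written as a cosine of phase -
    pi / 2, has mean 0; the cosine has mean exp(- Var(t Y_i - s Y_j) / 2), whose cross term is the
    factor carrying the correlation. *)
Lemma ip_cas_standardize i j (t s : R) :
  ip P (fun w => cas (t * Y i w)) (fun w => cas (s * Y j w)) =
  expR (- t ^+ 2 / 2) * expR (- s ^+ 2 / 2) * expR (ip P (Y i) (Y j) * (t * s)).
Proof.
have icos (a b th : R) : P.-integrable setT
    (EFin \o (fun w => cos (a * Y i w + b * Y j w + th))).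
  apply: L2_integrable; apply: (@L2_bounded _ _ _ _ _ 1).
    apply: (@measurableT_comp _ _ _ _ _ _ (@cos R)).
      exact: continuous_measurable_fun (@continuous_cos R).
    apply: measurable_funD => //; apply: measurable_funD; apply: measurable_funM => //;
      exact: measurable_standardize.
  by move=> w; rewrite ler_norml cos_geN1 cos_le1.
have -> : ip P (fun w => cas (t * Y i w)) (fun w => cas (s * Y j w)) =
    Exp P (fun w => cos (t * Y i w + (- s) * Y j w + 0) +
                    cos (t * Y i w + s * Y j w + - (pi / 2))).
  apply: eq_Exp => w; move: (Y i w) (Y j w) => y z.
  rewrite addr0 cosBpihalf mulNr cosB sinD /cas.
  by move: (cos (t * y)) (sin (t * y)) (cos (s * z)) (sin (s * z)) => *; ring.
rewrite ExpD// !Exp_cos_standardize cos0 cosN cos_pihalf mul0r addr0 mul1r.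
rewrite -!expRD; congr expR.
by move: (ip P (Y i) (Y j)) => r; field.
Qed.

Lemma Exp_cas_standardize i (t : R) :
  Exp P (fun w => cas (t * Y i w)) = expR (- t ^+ 2 / 2).
Proof.
have := ip_cas_standardize i i t 0.
rewrite (_ : ip P _ _ = Exp P (fun w => cas (t * Y i w))); last first.
  by apply: eq_Exp => w; rewrite mul0r cas0 mulr1.
by move=> ->; rewrite expr0n/= oppr0 mul0r mulr0 mulr0 expR0 !mulr1.
Qed.

Lemma cov_cas_sum i j (s1 s2 : seq (R * R)) :
  cov P (fun w => cas_sum s1 (Y i w)) (fun w => cas_sum s2 (Y j w)) =
  \sum_(p <- s1) \sum_(q <- s2) (p.1 * expR (- p.2 ^+ 2 / 2)) *
    (q.1 * expR (- q.2 ^+ 2 / 2)) * (expR (ip P (Y i) (Y j) * (p.2 * q.2)) - 1).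
Proof.
have Lcas k (t : R) : L2 P (fun w => cas (t * Y k w)).
  apply: (@L2_bounded _ _ _ _ _ 2); last by move=> w; exact: normr_cas.
  apply: (measurableT_comp measurable_cas); apply: measurable_funM => //.
  exact: measurable_standardize.
have LZ k (p : R * R) : L2 P (fun w => p.1 * cas (p.2 * Y k w)) by exact: L2Z.
have E k s : Exp P (fun w => cas_sum s (Y k w)) = \sum_(p <- s) p.1 * expR (- p.2 ^+ 2 / 2).
  rewrite /cas_sum Exp_sum; last by move=> p; exact: L2_integrable.
  apply: eq_bigr => p _; rewrite ExpZ ?Exp_cas_standardize//.
  exact: L2_integrable.
have I : ip P (fun w => cas_sum s1 (Y i w)) (fun w => cas_sum s2 (Y j w)) =
    \sum_(p <- s1) \sum_(q <- s2)
      p.1 * (q.1 * ip P (fun w => cas (p.2 * Y i w)) (fun w => cas (q.2 * Y j w))).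
  apply: etrans (ip_suml s1 (LZ i) (L2_sum s2 (LZ j))) _; apply: eq_bigr => p _.
  apply: etrans (ip_sumr s2 (LZ j) (LZ i p)) _; apply: eq_bigr => q _.
  by rewrite (ipZl _ (Lcas i _) (LZ j q)) (ipZr _ (Lcas j _) (Lcas i _)).
have sub3 (x y z x' y' z' : R) : x = x' -> y = y' -> z = z' -> x - y * z = x' - y' * z'.
  by move=> -> -> ->.
apply: etrans (sub3 _ _ _ _ _ _ I (E i s1) (E j s2)) _.
rewrite mulr_suml -sumrB; apply: eq_bigr => p _.
rewrite mulr_sumr -sumrB; apply: eq_bigr => q _.
rewrite (ip_cas_standardize i j).
move: (ip P (Y i) (Y j)) => r.
move: (expR (- p.2 ^+ 2 / 2)) (expR (- q.2 ^+ 2 / 2)) (expR (r * (p.2 * q.2))) => x y z; ring.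
Qed.

Variable lam : R.
Hypothesis lamP : forall w : 'I_n -> R,
  lam * \sum_i w i ^+ 2 <= \sum_i \sum_j w i * w j * ip P (Y i) (Y j).

Lemma sum_cov_cas_sum_ge (s : 'I_n -> seq (R * R)) :
  lam * \sum_i cov P (fun w => cas_sum (s i) (Y i w)) (fun w => cas_sum (s i) (Y i w)) <=
  \sum_i \sum_j cov P (fun w => cas_sum (s i) (Y i w)) (fun w => cas_sum (s j) (Y j w)).
Proof.
have H := hadamard_pow_ge L2_standardize ip_standardize lamP.
(* The factors exp(- t^2 / 2) depend on one frequency each and are absorbed into the coefficients,
   which leaves the kernel exp(rho t s) - 1. *)
pose s' i := [seq (p.1 * expR (- p.2 ^+ 2 / 2), p.2) | p <- s i].
have := exp_kernel_ge s' H.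
rewrite [leLHS](_ : _ = lam * \sum_i cov P (fun w => cas_sum (s i) (Y i w))
    (fun w => cas_sum (s i) (Y i w))); last first.
  congr (_ * _); apply: eq_bigr => i _; rewrite cov_cas_sum /s' big_map.
  apply: eq_bigr => p _; rewrite big_map; apply: eq_bigr => q _ /=.
  by rewrite ip_standardize mul1r.
move=> h; apply: (le_trans h); rewrite le_eqVlt; apply/orP; left; apply/eqP.
apply: eq_bigr => i _; apply: eq_bigr => j _; rewrite cov_cas_sum /s' big_map.
by apply: eq_bigr => p _; rewrite big_map; apply: eq_bigr => q _.
Qed.

Lemma sum_cov_ge (h : 'I_n -> R -> R) :
  (forall i, measurable_fun [set: R] (h i)) ->
  (forall i, L2 P (fun w => h i (X i w))) ->
  lam * \sum_i cov P (fun w => h i (X i w)) (fun w => h i (X i w)) <=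
  \sum_i \sum_j cov P (fun w => h i (X i w)) (fun w => h j (X j w)).
Proof.
move=> mh Lh.
(* The component as a function of the standardized variable, for which the covariance formula is
   available. *)
pose f i y := h i (mean P (X i) + sd i * y).
have fE i : (fun w => f i (Y i w)) = (fun w => h i (X i w)).
  by apply/funext => w; rewrite /f standardizeK.
have mf i : measurable_fun [set: R] (f i).
  apply: (measurableT_comp (mh i)); apply: measurable_funD; first exact: measurable_cst.
  by apply: measurable_funM; [exact: measurable_cst|exact: measurable_id].
have Lf i : L2 P (fun w => f i (Y i w)) by rewrite fE.
have /choice[s hs] : forall p : 'I_n * nat, exists s : seq (R * R),
    sqnorm P (fun w => f p.1 (Y p.1 w) - cas_sum s (Y p.1 w)) <= p.2.+1%:R^-1.
  move=> [i k] /=.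
  have [_ _ H] := L2_approximable_L2 (measurable_standardize i) (mf i) (Lf i).
  by apply: H; rewrite invr_gt0.
pose g i k w := cas_sum (s (i, k)) (Y i w).
have Lg i k : L2 P (g i k) by exact: L2_cas_sum (measurable_standardize i) _.
have cg i : sqnorm P (fun w => g i k w - f i (Y i w)) @[k --> \oo] --> (0 : R).
  apply: (@squeeze_cvgr _ _ _ _ (cst 0) (fun k => k.+1%:R^-1)).
  - apply: nearW => k; rewrite ip_ge0/=.
    rewrite (_ : sqnorm P _ = sqnorm P (fun w => f i (Y i w) - g i k w)); last first.
      by apply: eq_Exp => w; ring.
    exact: (hs (i, k)).
  - exact: cvg_cst.
  - exact: cvg_harmonic.
have cc i j : cov P (g i k) (g j k) @[k --> \oo] -->
    cov P (fun w => h i (X i w)) (fun w => h j (X j w)).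
  by rewrite -!fE; exact: cvg_cov.
have cL : lam * \sum_i cov P (g i k) (g i k) @[k --> \oo] -->
    lam * \sum_i cov P (fun w => h i (X i w)) (fun w => h i (X i w)).
  by apply: cvgM; [exact: cvg_cst|apply: cvg_Rsum => i; exact: cc].
have cU : \sum_i \sum_j cov P (g i k) (g j k) @[k --> \oo] -->
    \sum_i \sum_j cov P (fun w => h i (X i w)) (fun w => h j (X j w)).
  by apply: cvg_Rsum => i; apply: cvg_Rsum => j; exact: cc.
rewrite -(cvg_lim _ cL)// -[leRHS](cvg_lim _ cU)//.
apply: ler_lim; [by apply/cvg_ex; eexists; exact: cL|by apply/cvg_ex; eexists; exact: cU|].
by apply: nearW => k; exact: sum_cov_cas_sum_ge.
Qed.

End standard_gaussian_family.

(** * Comparison of the two distributions *)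

Section equal_laws.
Context {R : realType} {d : measure_display} {T : measurableType d}.
Variables (P Q : probability T R) (Z : T -> R).
Hypothesis mZ : measurable_fun [set: T] Z.
Hypothesis PQ : forall A : set R, measurable A -> P (Z @^-1` A) = Q (Z @^-1` A).

Let eq_pushforward (h : R -> \bar R) :
  (\int[pushforward P Z]_x h x = \int[pushforward Q Z]_x h x)%E.
Proof. by apply: eq_measure_integral => A mA _; exact: PQ. Qed.

Lemma integrable_same_law (f : R -> R) : measurable_fun [set: R] f ->
  P.-integrable [set: T] (EFin \o (fun w => f (Z w))) ->
  Q.-integrable [set: T] (EFin \o (fun w => f (Z w))).
Proof.
move=> mf /integrableP[_ fi].
have mEf : measurable_fun [set: R] (EFin \o f) by exact/measurable_EFinP.
have mE : measurable_fun [set: R] (abse \o (EFin \o f)) by exact: measurableT_comp.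
apply/integrableP; split; first exact: (measurableT_comp mEf mZ).
have EP := @ge0_integral_pushforward _ _ _ _ _ Z mZ P setT _ measurableT mE
  (fun y _ => abse_ge0 _).
have EQ := @ge0_integral_pushforward _ _ _ _ _ Z mZ Q setT _ measurableT mE
  (fun y _ => abse_ge0 _).
by move: fi; rewrite preimage_setT in EP EQ; rewrite -[X in (X < _)%E -> _]EP
  -[X in _ -> (X < _)%E]EQ eq_pushforward.
Qed.

Lemma Exp_same_law (f : R -> R) : measurable_fun [set: R] f ->
  P.-integrable [set: T] (EFin \o (fun w => f (Z w))) ->
  Exp P (fun w => f (Z w)) = Exp Q (fun w => f (Z w)).
Proof.
move=> mf fi; have fi' := integrable_same_law mf fi.
have mEf : measurable_fun [set: R] (EFin \o f) by exact/measurable_EFinP.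
rewrite /Exp; congr fine.
have EP := @integral_pushforward _ _ _ _ _ Z mZ P setT _ mEf fi measurableT.
have EQ := @integral_pushforward _ _ _ _ _ Z mZ Q setT _ mEf fi' measurableT.
by rewrite -[LHS]EP -[RHS]EQ eq_pushforward.
Qed.

Lemma L2_same_law (f : R -> R) : measurable_fun [set: R] f ->
  L2 P (fun w => f (Z w)) -> L2 Q (fun w => f (Z w)).
Proof.
move=> mf [_ fi]; split; first exact: (measurableT_comp mf mZ).
exact: (integrable_same_law (measurable_funX 2 mf) fi).
Qed.

Lemma cov_same_law (f : R -> R) : measurable_fun [set: R] f -> L2 P (fun w => f (Z w)) ->
  cov P (fun w => f (Z w)) (fun w => f (Z w)) = cov Q (fun w => f (Z w)) (fun w => f (Z w)).
Proof.
move=> mf Lf; rewrite /cov /ip -(Exp_same_law mf (L2_integrable Lf)).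
have mff : measurable_fun [set: R] (fun y => f y * f y) by exact: measurable_funM.
by rewrite (Exp_same_law mff (L2M_integrable Lf Lf)).
Qed.

End equal_laws.

Section delta_sums.
Context {R : realType} {n : nat}.

Lemma sum_delta_sqr (i : 'I_n) : \sum_j (j == i)%:R ^+ 2 = 1 :> R.
Proof.
rewrite (bigD1 i)//= eqxx expr1n big1 ?addr0// => j /negbTE ->.
by rewrite expr0n.
Qed.

Lemma sum_delta_form (i : 'I_n) (rho : 'I_n -> 'I_n -> R) :
  \sum_j \sum_k (j == i)%:R * (k == i)%:R * rho j k = rho i i.
Proof.
rewrite (bigD1 i)//= [X in _ + X]big1 ?addr0; last first.
  by move=> j /negbTE ->; rewrite big1// => k _; rewrite !mul0r.
rewrite (bigD1 i)//= big1 ?addr0 ?eqxx ?mul1r// => k /negbTE ->.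
by rewrite mulr0 mul0r.
Qed.

End delta_sums.

(** * Ratio of second moments of additive functions *)

Section additive_ratio.
Context {R : realType} {d : measure_display} {T : measurableType d}.
Variables (n : nat) (P Q : probability T R) (X : 'I_n -> T -> R).
Hypothesis mX : forall i, measurable_fun [set: T] (X i).
Hypothesis PQ : forall i (A : set R), measurable A -> P (X i @^-1` A) = Q (X i @^-1` A).
Hypothesis vX : forall i, 0 < var P (X i).
Hypothesis gX : forall i j, bivariate_gaussian P (X i) (X j).
Local Notation Y := (standardize P X).

Lemma qform_tildeSigma (w : 'rV[R]_n) : qform (tildeSigma P X) w w =
  ip P (fun x => \sum_i w 0 i * Y i x) (fun x => \sum_i w 0 i * Y i x).
Proof.
have LY := L2_standardize mX gX.
rewrite ip_sum_sum; last by move=> i; exact: L2Z.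
rewrite qformE; apply: eq_bigr => i _; apply: eq_bigr => j _.
rewrite ipZl// ?ipZr// ?mulrA; last exact: L2Z.
by rewrite mxE.
Qed.

Lemma tildeSigma_sym : (tildeSigma P X)^T = tildeSigma P X.
Proof. by apply/matrixP => i j; rewrite !mxE; apply: eq_Exp => w; exact: mulrC. Qed.

Lemma tildeSigma_ge0 (w : 'rV[R]_n) : 0 <= qform (tildeSigma P X) w w.
Proof. by rewrite qform_tildeSigma ip_ge0. Qed.

Lemma lambda_min_tildeSigma (w : 'I_n -> R) :
  lambda_min (tildeSigma P X) * \sum_i w i ^+ 2 <=
  \sum_i \sum_j w i * w j * ip P (Y i) (Y j).
Proof.
have := lambda_min_le_qform (\row_i w i) tildeSigma_sym tildeSigma_ge0.
rewrite qformE /sqlen.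
under eq_bigr do rewrite mxE.
under [leRHS]eq_bigr do under eq_bigr do rewrite !mxE.
by [].
Qed.

(** A coordinate vector gives the form its diagonal value 1. The bound is there for the squared
    mean, which needs n / lambda_min to be at least 1. *)
Lemma lambda_min_tildeSigma_le1 (i : 'I_n) : lambda_min (tildeSigma P X) <= 1.
Proof.
have := lambda_min_tildeSigma (fun j => (j == i)%:R).
by rewrite sum_delta_sqr (sum_delta_form i (fun j k => ip P (Y j) (Y k)))
  (ip_standardize mX vX gX) mulr1.
Qed.

(** A second moment is a variance plus a squared mean. The variance pays n when it is bounded by the
    sum of the marginal variances under Q, and 1 / lam when that sum is bounded back under P; the
    squared mean is the same on both sides. *)
Lemma additive_second_moment_ratio (h : 'I_n -> R -> R) :
  (forall i, measurable_fun [set: R] (h i)) ->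
  (forall i, L2 P (fun w => h i (X i w))) ->
  let S w := \sum_i h i (X i w) in
  let lam := lambda_min (tildeSigma P X) in
  0 < lam -> ip Q S S <= n%:R / lam * ip P S S.
Proof.
move=> mh Lh S lam lam0.
have LQ i : L2 Q (fun w => h i (X i w)) by exact: (L2_same_law (mX i) (PQ i)).
have hQ := ip_sum_le LQ.
apply: (le_trans hQ); rewrite (ip_sum_cov Lh).
have EPQ i : Exp Q (fun w => h i (X i w)) = Exp P (fun w => h i (X i w)).
  by rewrite (Exp_same_law (mX i) (PQ i) (mh i) (L2_integrable (Lh i))).
have cPQ i : cov Q (fun w => h i (X i w)) (fun w => h i (X i w)) =
    cov P (fun w => h i (X i w)) (fun w => h i (X i w)).
  by rewrite (cov_same_law (mX i) (PQ i) (mh i) (Lh i)).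
under eq_bigr do rewrite cPQ.
under [X in _ + X ^+ 2]eq_bigr do rewrite EPQ.
rewrite [leRHS]mulrDr; apply: lerD.
  rewrite -mulrA ler_wpM2l// mulrC ler_pdivlMr// mulrC.
  exact: (sum_cov_ge mX vX gX lambda_min_tildeSigma mh Lh).
(* For n = 0 the factor n / lam is below 1, but the sum of means is then empty. *)
case: (posnP n) => [n0|n0].
  rewrite big1 ?expr0n/= ?mulr0// => -[i i_lt] _.
  by exfalso; move: i_lt; rewrite n0.
rewrite -[leLHS]mul1r ler_wpM2r ?sqr_ge0// ler_pdivlMr// mul1r.
apply: (le_trans (lambda_min_tildeSigma_le1 (Ordinal n0))).
by rewrite ler1n.
Qed.

End additive_ratio.

Unset Implicit Arguments.

Theorem mainTheorem4 (R : realType) (dT : measure_display) (T : measurableType dT)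
  (n : nat) (P Q : probability T R) (X : 'I_n -> T -> R) :
  (forall i, measurable_fun setT (X i)) ->
  (forall i (A : set R), measurable A ->
     P (X i @^-1` A) = Q (X i @^-1` A)) ->
  (forall i, 0 < var P (X i)) ->
  (forall i j, bivariate_gaussian P (X i) (X j)) ->
  (forall i j, bivariate_gaussian Q (X i) (X j)) ->
  (tau P Q X <=
     (if lambda_min (tildeSigma P X) == 0%R then +oo
      else (n%:R / lambda_min (tildeSigma P X))%:E))%E.
Proof.
move=> mX PQ vX gP _; case: ifPn => [_|lam_neq0]; first exact: leey.
set lam := lambda_min _ in lam_neq0 *.
have lam0 : 0 < lam.
  rewrite lt_neqAle eq_sym lam_neq0 /=; apply: lambda_min_ge0.
  exact: (tildeSigma_ge0 mX gP).
apply: ub_ereal_sup => _ [f [g [Ff Fg ->]]].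
(* The class is linear, so a difference of two members is again additive, with these components. *)
pose h i y := f i y - g i y.
have L2F (f' : 'I_n -> R -> R) i : additive_component P X f' ->
    L2 P (fun w => f' i (X i w)).
  move=> /(_ i)[mf' fi']; apply: L2_lty => //.
  exact: (measurableT_comp mf' (mX i)).
have mh i : measurable_fun [set: R] (h i).
  by apply: measurable_funB; [exact: (Ff i).1|exact: (Fg i).1].
have Lh i : L2 P (fun w => h i (X i w)) by apply: L2B; exact: L2F.
have LhQ i : L2 Q (fun w => h i (X i w)) by exact: (L2_same_law (mX i) (PQ i)).
pose S w := \sum_i h i (X i w).
have SE w : additive_eval X f w - additive_eval X g w = S w by rewrite -sumrB.
under eq_integral do rewrite SE.
under [X in eratio _ X]eq_integral do rewrite SE.
rewrite (L2_integralE (L2_sum _ Lh)) (L2_integralE (L2_sum _ LhQ)).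
have ratio := additive_second_moment_ratio mX PQ vX gP mh Lh lam0.
have nlam0 : 0 <= n%:R / lam by rewrite divr_ge0// ltW.
rewrite /eratio !eqe; case: eqP => [P0|/eqP P0].
  (* A zero denominator forces a zero numerator, so [eratio] takes the value 0 and not infinity. *)
  rewrite -/S P0 mulr0 in ratio.
  by rewrite eq_le ratio ip_ge0 lee_fin.
rewrite inver (negbTE P0) -EFinM lee_fin ler_pdivrMr//.
by rewrite lt_neqAle eq_sym P0 ip_ge0.
Qed.
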